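(* Let $\mathcal{U}=\{u_1,\dots,u_p\}\subset\mathbb{R}^3$ and let $m\leq p$ be the number of vertices of the convex hull of $\pi(\mathcal{U})$ on $\mathbb{S}^2$. If there exists an orthonormal basis $\mathcal{F}=\{f_1,f_2,f_3\}$ of $\mathbb{R}^3$ such that the coordinates $f_i^\top u_j$ of all vectors in $\mathcal{U}$ with respect to $\mathcal{F}$ are nonnegative, then the complexity of the hull-normal algorithm (described in the context), which computes this basis, is $\mathcal{O}(p^2\log m)$. The algorithm fails if $\mathcal{F}$ does not exist.
   Context: $\mathbb{S}^2$ is the Euclidean unit sphere in $\mathbb{R}^3$, and $\pi:\mathbb{R}^3\setminus\{0\}\to\mathbb{S}^2$, $\pi(x)=x/\|x\|$; the vectors in $\mathcal{U}$ are nonzero so that $\pi(\mathcal{U})$ is defined. Convex hull on $\mathbb{S}^2$ means spherically convex hull. Let $U$ be the $3\times p$ matrix with columns $u_1,\dots,u_p$; matrix inequalities are entrywise. The hull-normal algorithm is the following. (1) Compute the spherically convex hull $P$ of $\pi(u_1),\dots,\pi(u_p)$ and list its $m$ vertices $\pi(u_{k_1}),\dots,\pi(u_{k_m})$ in order of traversal of the boundary of $P$, which can be done in complexity $\mathcal{O}(p\log m)$; put $k_{m+1}=k_1$. (2) For each $j\in\{1,\dots,m\}$ take a unit normal $g$ to the plane spanned by $u_{k_j}$ and $u_{k_{j+1}}$ and verify whether $U^\top U\geq U^\top gg^\top U\geq 0$. The right inequality says that all of $\mathcal{U}$ lies in one closed half space bounded by the plane $H=g^\perp$; the left inequality says that no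 two of the orthogonal projections of $u_1,\dots,u_p$ onto $H$ make an obtuse angle. The left inequality is verified by processing the projected vectors one at a time within the two-dimensional space $H$, keeping track of a positively oriented pair with largest mutual angle: for each new vector, inner products with the two vectors of the current pair decide whether the largest angle becomes obtuse (in which case the process for this $g$ is terminated), and inner products with the two vectors of the pair rotated over a right angle decide how the pair is updated. This evaluates only $4p$ inner products instead of all $\frac12p(p-1)$. (3) If the condition holds for some $g$, set $f_1=g$ or $f_1=-g$, such that $f_1^\top u_j\geq 0$ for all $j$, and let $f_2,f_3$ be the orthonormal basis of $H$ given by the rotation in $H$ that maps the first vector of the final positively oriented angle-maximizing pair onto the (positive direction of the) first coordinate axis, so that all projections are mapped into the nonnegative quadrant. If the condition holds for none of the $m$ normals, the algorithm fails. *)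

(* Defs.v *)
(* MathComp-Analysis world. *)
From HB Require Import structures.
From mathcomp Require Import all_boot all_order all_algebra.
From mathcomp Require Import all_classical all_reals all_analysis.

Set Implicit Arguments.
Unset Strict Implicit.
Unset Printing Implicit Defensive.

Import Order.TTheory GRing.Theory Num.Theory.
Import numFieldNormedType.Exports.

Local Open Scope classical_set_scope.
Local Open Scope ring_scope.

(* Spherical geometry.  The norm `|x| that the library puts on matrices is the
   sup norm, so the Euclidean norm has to be defined; the topologies agree. *)

Section Sphere.
Variable R : realType.
Implicit Types (x y v : 'cV[R]_3) (A P : set 'cV[R]_3).

Definition dotp x y : R := (x^T *m y) 0 0.

Definition enorm x : R := Num.sqrt (dotp x x).

Definition sphere : set 'cV[R]_3 := [set x | enorm x = 1].

Definition sproj x : 'cV[R]_3 := (enorm x)^-1 *: x.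

(* The shortest geodesic from x to y, for x and y on the sphere and y != - x.
   For y = - x there is no unique one, and this is just the set {x, - x}, so
   that the next two definitions ask nothing of antipodal points. *)
Definition arc x y : set 'cV[R]_3 :=
  [set z | exists s t : R,
     [/\ 0 <= s, 0 <= t, s *: x + t *: y != 0 & z = sproj (s *: x + t *: y)]].

Definition sph_convex A : Prop :=
  A `<=` sphere /\ forall x y, A x -> A y -> arc x y `<=` A.

Definition sph_hull A : set 'cV[R]_3 :=
  [set z | forall B, sph_convex B -> A `<=` B -> B z].

(* Points of P that are not in the relative interior of a geodesic arc of P. *)
Definition sph_vertices P : set 'cV[R]_3 :=
  [set v | P v /\ forall x y, P x -> P y -> arc x y v -> v = x \/ v = y].

(* The boundary relative to the sphere; the sphere is closed, so closures may
   be taken in the ambient space. *)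
Definition sph_boundary P : set 'cV[R]_3 :=
  closure P `&` closure (sphere `\` P).

End Sphere.

Section Configuration.
Variables (R : realType) (p : nat).
Implicit Types (U : 'M[R]_(3, p)) (F : 'M[R]_3).

Definition proj_hull U : set 'cV[R]_3 :=
  sph_hull (range (fun j => sproj (col j U))).

Definition hull_vertices U : set 'cV[R]_3 := sph_vertices (proj_hull U).

(* ks lists, without repetition, indices k whose points sproj (col k U) are
   the vertices of the hull, in an order of traversal of its boundary:
   cyclically consecutive vertices are joined by an arc of the boundary. *)
Definition boundary_traversal U (ks : seq 'I_p) : Prop :=
  let vs := [seq sproj (col k U) | k <- ks] in
  [/\ uniq vs, [set` vs] = hull_vertices U &
      cycle (fun v w => `[< arc v w `<=` sph_boundary (proj_hull U) >]) vs].

(* The basis vectors f_1, f_2, f_3 are the columns of F. *)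
Definition orthonormal_basis F : Prop := F^T *m F = 1%:M.

Definition nonneg_coords F U : Prop := forall i j, 0 <= (F^T *m U) i j.

Definition nonneg_basis U F : Prop := orthonormal_basis F /\ nonneg_coords F U.

End Configuration.

(* Real-RAM programs.  The type T of the contents of the registers is abstract
   in every algorithm below, so that an instruction is the only way for an
   algorithm to compute with, or to branch on, numbers.  The cost of a run is
   the number of instructions that it executes. *)

Variant arith := Add | Sub | Mul | Div.

Inductive prog (T A : Type) : Type :=
| Ret of A
| Lit of nat & (T -> prog T A)
| Op of arith & T & T & (T -> prog T A)
| Sqrt of T & (T -> prog T A)
| Leq of T & T & (bool -> prog T A).

Arguments Ret {T A} _.
Arguments Lit {T A} _ _.
Arguments Op {T A} _ _ _ _.
Arguments Sqrt {T A} _ _.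
Arguments Leq {T A} _ _ _.

Fixpoint bind (T A B : Type) (c : prog T A) (f : A -> prog T B) : prog T B :=
  match c with
  | Ret a => f a
  | Lit n k => Lit n (fun z => bind (k z) f)
  | Op o x y k => Op o x y (fun z => bind (k z) f)
  | Sqrt x k => Sqrt x (fun z => bind (k z) f)
  | Leq x y k => Leq x y (fun b => bind (k b) f)
  end.

Notation "'let*' x := c 'in' k" := (bind c (fun x => k))
  (at level 200, x name, c at level 200, k at level 200, right associativity).

Definition arith_eval (R : realType) (o : arith) (x y : R) : R :=
  match o with Add => x + y | Sub => x - y | Mul => x * y | Div => x / y end.

Fixpoint result (R : realType) (A : Type) (c : prog R A) : A :=
  match c with
  | Ret a => a
  | Lit n k => result (k n%:R)
  | Op o x y k => result (k (arith_eval o x y))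
  | Sqrt x k => result (k (Num.sqrt x))
  | Leq x y k => result (k (x <= y))
  end.

Fixpoint cost (R : realType) (A : Type) (c : prog R A) : nat :=
  match c with
  | Ret _ => 0
  | Lit n k => (cost (k n%:R)).+1
  | Op o x y k => (cost (k (arith_eval o x y))).+1
  | Sqrt x k => (cost (k (Num.sqrt x))).+1
  | Leq x y k => (cost (k (x <= y))).+1
  end.

Section Algorithm.
Variable T : Type.
Implicit Types (a b c g u x y : 'cV[T]_3).

Definition lit (n : nat) : prog T T := Lit n Ret.
Definition op (o : arith) (x y : T) : prog T T := Op o x y Ret.
Definition sqrt_ (x : T) : prog T T := Sqrt x Ret.
Definition leq_ (x y : T) : prog T bool := Leq x y Ret.

Definition i0 : 'I_3 := inord 0.
Definition i1 : 'I_3 := inord 1.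
Definition i2 : 'I_3 := inord 2.

Definition mkvec (a0 a1 a2 : T) : 'cV[T]_3 :=
  \col_i tnth [tuple a0; a1; a2] i.

Definition mkbasis (f1 f2 f3 : 'cV[T]_3) : 'M[T]_3 :=
  \matrix_(i, j) (tnth [tuple f1; f2; f3] j) i 0.

Definition dot_ x y : prog T T :=
  let* a := op Mul (x i0 0) (y i0 0) in
  let* b := op Mul (x i1 0) (y i1 0) in
  let* c := op Mul (x i2 0) (y i2 0) in
  let* d := op Add a b in
  op Add d c.

Definition scale_ (s : T) x : prog T 'cV[T]_3 :=
  let* a := op Mul s (x i0 0) in
  let* b := op Mul s (x i1 0) in
  let* c := op Mul s (x i2 0) in
  Ret (mkvec a b c).

Definition sub_ x y : prog T 'cV[T]_3 :=
  let* a := op Sub (x i0 0) (y i0 0) in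
  let* b := op Sub (x i1 0) (y i1 0) in
  let* c := op Sub (x i2 0) (y i2 0) in
  Ret (mkvec a b c).

Definition opp_ x : prog T 'cV[T]_3 :=
  let* z := lit 0 in sub_ (mkvec z z z) x.

Definition det2_ (a b c d : T) : prog T T :=
  let* m := op Mul a d in
  let* n := op Mul b c in
  op Sub m n.

Definition cross_ x y : prog T 'cV[T]_3 :=
  let* a := det2_ (x i1 0) (x i2 0) (y i1 0) (y i2 0) in
  let* b := det2_ (x i2 0) (x i0 0) (y i2 0) (y i0 0) in
  let* c := det2_ (x i0 0) (x i1 0) (y i0 0) (y i1 0) in
  Ret (mkvec a b c).

Definition is_zero_ x : prog T bool :=
  let* n := dot_ x x in
  let* z := lit 0 in
  leq_ n z.

Definition normalize_ x : prog T 'cV[T]_3 :=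
  let* n := dot_ x x in
  let* l := sqrt_ n in
  let* o := lit 1 in
  let* s := op Div o l in
  scale_ s x.

(* A nonzero vector orthogonal to x != 0. *)
Definition some_orthogonal_ x : prog T 'cV[T]_3 :=
  let* z := lit 0 in
  let* o := lit 1 in
  let* c := cross_ x (mkvec o z z) in
  let* b := is_zero_ c in
  if b then cross_ x (mkvec z o z) else Ret c.

(* A unit normal to a plane that contains a and b.  The plane is unique unless
   a and b are parallel, which happens when the hull has a single vertex, where
   a = b, or two antipodal ones. *)
Definition unit_normal_ a b : prog T 'cV[T]_3 :=
  let* c := cross_ a b in
  let* z := is_zero_ c in
  let* n := if z then some_orthogonal_ a else Ret c in
  normalize_ n.

(* Whether g^T u >= 0 for all u in us, and whether g^T u <= 0 for all of them;
   the inequality U^T g g^T U >= 0 says that one of the two holds. *)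
Fixpoint halfspace_ g (us : seq 'cV[T]_3) : prog T (bool * bool) :=
  match us with
  | [::] => Ret (true, true)
  | u :: us' =>
      let* s := dot_ g u in
      let* z := lit 0 in
      let* bp := leq_ z s in
      let* bn := leq_ s z in
      let* r := halfspace_ g us' in
      Ret (bp && r.1, bn && r.2)
  end.

Definition project_ g u : prog T 'cV[T]_3 :=
  let* s := dot_ g u in
  let* v := scale_ s g in
  sub_ u v.

(* The rotation over a positive right angle of the plane orthogonal to the unit
   vector g, with the orientation given by g, is the cross product by g on the
   left.
   The pair (v1, v2) is positively oriented in that plane and has the largest
   angle among the projected vectors processed so far; None means that this
   angle becomes obtuse. *)
Fixpoint sweep_ g (v1 v2 : 'cV[T]_3) (us : seq 'cV[T]_3) :
    prog T (option ('cV[T]_3 * 'cV[T]_3)) :=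
  match us with
  | [::] => Ret (Some (v1, v2))
  | u :: us' =>
      let* w := project_ g u in
      let* s1 := dot_ v1 w in
      let* s2 := dot_ v2 w in
      let* z := lit 0 in
      let* b1 := leq_ z s1 in
      let* b2 := leq_ z s2 in
      if b1 && b2 then
        let* r1 := cross_ g v1 in
        let* r2 := cross_ g v2 in
        let* t1 := dot_ r1 w in
        let* t2 := dot_ r2 w in
        let* c1 := leq_ z t1 in
        let* c2 := leq_ t2 z in
        sweep_ g (if c1 then v1 else w) (if c2 then v2 else w) us'
      else Ret None
  end.

Definition basis_from_ (same_side : bool) g (v1 : 'cV[T]_3) : prog T 'M[T]_3 :=
  let* f1 := if same_side then Ret g else opp_ g in
  let* f2 := normalize_ v1 in
  let* f3 := cross_ g f2 in
  Ret (mkbasis f1 f2 f3).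

(* The vector a is itself in the plane and among the us, so it equals its own
   projection and can serve as the initial (degenerate) pair. *)
Definition try_edge_ (us : seq 'cV[T]_3) a b : prog T (option 'M[T]_3) :=
  let* g := unit_normal_ a b in
  let* h := halfspace_ g us in
  if h.1 || h.2 then
    let* r := sweep_ g a a us in
    match r with
    | Some (v1, _) => let* F := basis_from_ h.1 g v1 in Ret (Some F)
    | None => Ret None
    end
  else Ret None.

Fixpoint try_edges_ (us : seq 'cV[T]_3) (es : seq ('cV[T]_3 * 'cV[T]_3)) :
    prog T (option 'M[T]_3) :=
  match es with
  | [::] => Ret None
  | (a, b) :: es' =>
      let* r := try_edge_ us a b in
      match r with
      | Some F => Ret (Some F)
      | None => try_edges_ us es'
      end
  end.

End Algorithm.

(* A hull subroutine receives the vectors and returns the indices of those that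
   give the vertices of the hull.  None as a result of hull_normal is failure. *)
Definition hull_routine :=
  forall (T : Type) (p : nat), 'M[T]_(3, p) -> prog T (seq 'I_p).

Definition hull_normal (hull : hull_routine) (T : Type) (p : nat)
    (U : 'M[T]_(3, p)) : prog T (option 'M[T]_3) :=
  let* ks := hull T p U in
  let vs := [seq col k U | k <- ks] in
  try_edges_ [seq col j U | j <- enum 'I_p] (zip vs (rot 1 vs)).

(* log m, read as log 2 for m <= 1: a bound that vanishes for m = 1 cannot be
   meant, and O(log m) is unaffected for m >= 2. *)
Definition logm (R : realType) (m : nat) : R := ln (maxn m 2)%:R.

Definition nonzero_cols (R : realType) (p : nat) (U : 'M[R]_(3, p)) : Prop :=
  forall j, col j U != 0.

Definition hull_routine_correct (R : realType) (hull : hull_routine) : Prop :=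
  forall (p : nat) (U : 'M[R]_(3, p)), (0 < p)%N -> nonzero_cols U ->
    boundary_traversal U (result (hull R p U)).

(* Complexity O(p log m). *)
Definition hull_routine_cost (R : realType) (hull : hull_routine) : Prop :=
  exists C : R, forall (p m : nat) (U : 'M[R]_(3, p)),
    (0 < p)%N -> nonzero_cols U -> (hull_vertices U #= `I_m)%card ->
    (cost (hull R p U))%:R <= C * (p%:R * logm R m).

(* Main.v *)
Require Import Defs.
From mathcomp Require Import all_boot all_order all_algebra.
From mathcomp Require Import all_classical all_reals all_analysis.
From mathcomp Require Import ring lra zify.

(** The statement has an easy half and a hard half. Below, x * y is the vector
product crossp and x.y the inner product.

Easy half: whatever the algorithm returns is a nonnegative basis. If the
sweep for a unit normal g ends with the pair (v1, v2), then v1, v2 make an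
angle of at most a right angle and all projections are nonnegative
combinations of them (sweep_sound); hence g or - g, the direction of v1 and
g * v1 form a nonnegative basis (try_edge_sound). In particular the algorithm
fails when no such basis exists. The cost is that of the hull routine plus
O(p) for each of at most p edges.

Hard half: if a nonnegative basis exists, some edge is accepted. After a
rotation all vectors lie in the nonnegative orthant. Let g be the first basis
vector, and let a, b be the vectors whose projections along g are angularly
extreme. The directions x from which a and b remain extreme, and which are
nonnegative on all vectors, form a polyhedral cone. On it the condition that
the projections of a and b along x do not make an obtuse angle reads
q(x) >= 0, where q is the quadratic form (x * a).(x * b), and by
Cauchy-Schwarz the set q < 0 is convex there (qform_le0). Therefore g can be
moved inside the cone along segments: one of the two ends of a segment through
g again satisfies q >= 0 (admissible_between) and makes one more constraint
tight. When the tight constraints have rank two, x itself, or x * a, or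
x * b, is orthogonal to two nonparallel vectors u_i, u_j, so that it is the
normal of a facet, and the frame that contains it remains nonnegative
(exists_facet).

It remains to see that this facet is visited. Its extreme vectors are two
vertices of the hull (facet_vertices). An arc between vertices that lies in
the boundary has all vectors on one side of its plane
(boundary_arc_one_sided), and a vertex v has at most two such neighbours: of
three, two would see all vectors on the same side of their planes through v,
which forces these planes to be equal and to contain three vertices
(at_most_two_neighbours). Both neighbours of v in a cyclic traversal are of
this kind, so the other end of the facet is one of them (cycle_adjacent). *)

Import Order.TTheory GRing.Theory Num.Theory.
Import numFieldNormedType.Exports.

Set Implicit Arguments.
Unset Strict Implicit.
Unset Printing Implicit Defensive.

Local Open Scope classical_set_scope.
Local Open Scope ring_scope.

(** * Vector algebra in dimension three *)

Lemma ord3P (i : 'I_3) : [\/ i = i0, i = i1 | i = i2].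
Proof.
case: i => [[|[|[|//]]] lti]; [constructor 1|constructor 2|constructor 3];
  by apply: val_inj; rewrite /= inordK.
Qed.

Section Vectors.
Variable R : realType.
Implicit Types (x y z n a v w : 'cV[R]_3) (s t : R).

Lemma mkvecE (a0 a1 a2 : R) :
  (mkvec a0 a1 a2 i0 0 = a0) * (mkvec a0 a1 a2 i1 0 = a1) *
  (mkvec a0 a1 a2 i2 0 = a2).
Proof. by rewrite !mxE !(tnth_nth a0) /= !inordK. Qed.

Lemma vec3P x y :
  x i0 0 = y i0 0 -> x i1 0 = y i1 0 -> x i2 0 = y i2 0 -> x = y.
Proof.
by move=> e0 e1 e2; apply/colP => i; case: (ord3P i) => ->.
Qed.

Lemma dotpE x y :
  dotp x y = x i0 0 * y i0 0 + x i1 0 * y i1 0 + x i2 0 * y i2 0.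
Proof.
rewrite /dotp mxE !big_ord_recl big_ord0 addr0 !mxE addrA.
have -> : ord0 = i0 by apply: val_inj; rewrite /= inordK.
have -> : lift i0 ord0 = i1 by apply: val_inj; rewrite /= !inordK.
by have -> : lift i0 (lift ord0 ord0) = i2
  by apply: val_inj; rewrite /= !inordK.
Qed.

Definition crossp x y : 'cV[R]_3 :=
  mkvec (x i1 0 * y i2 0 - x i2 0 * y i1 0)
        (x i2 0 * y i0 0 - x i0 0 * y i2 0)
        (x i0 0 * y i1 0 - x i1 0 * y i0 0).

Lemma crosspE x y :
  (crossp x y i0 0 = x i1 0 * y i2 0 - x i2 0 * y i1 0) *
  (crossp x y i1 0 = x i2 0 * y i0 0 - x i0 0 * y i2 0) *
  (crossp x y i2 0 = x i0 0 * y i1 0 - x i1 0 * y i0 0).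
Proof. by rewrite !mkvecE. Qed.

Definition det3 x y z : R := dotp x (crossp y z).

Definition vecE := (dotpE, crosspE, mkvecE, mxE).

Lemma dotp_crossp x y :
  dotp (crossp x y) (crossp x y) =
  dotp x x * dotp y y - dotp x y ^+ 2.
Proof. by rewrite !vecE; ring. Qed.

Lemma dotpC x y : dotp x y = dotp y x.
Proof. by rewrite !vecE; ring. Qed.

Lemma dotpDr x y z : dotp x (y + z) = dotp x y + dotp x z.
Proof. by rewrite !vecE; ring. Qed.

Lemma dotpZr s x y : dotp x (s *: y) = s * dotp x y.
Proof. by rewrite !vecE; ring. Qed.

Lemma dotpDl x y z : dotp (y + z) x = dotp y x + dotp z x.
Proof. by rewrite !vecE; ring. Qed.

Lemma dotpZl s x y : dotp (s *: y) x = s * dotp y x.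
Proof. by rewrite !vecE; ring. Qed.

Lemma dotp0r x : dotp x 0 = 0.
Proof. by rewrite !vecE; ring. Qed.

Lemma dotp_ge0 x : 0 <= dotp x x.
Proof. by rewrite dotpE; nra. Qed.

Lemma dotp_eq0 x : (dotp x x == 0) = (x == 0).
Proof.
apply/eqP/eqP => [|->]; last exact: dotp0r.
rewrite dotpE -!expr2 => h.
have [p0 p1 p2] := And3 (sqr_ge0 (x i0 0)) (sqr_ge0 (x i1 0)) (sqr_ge0 (x i2 0)).
by apply: vec3P; rewrite mxE; apply/eqP; rewrite -sqrf_eq0; apply/eqP; lra.
Qed.

Lemma dotp_gt0 x : (0 < dotp x x) = (x != 0).
Proof. by rewrite lt0r dotp_ge0 andbT dotp_eq0. Qed.

Lemma det3_crossp x y z : det3 x y z = dotp (crossp x y) z.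
Proof. by rewrite /det3 !vecE; ring. Qed.

Lemma det3C x y z : det3 x z y = - det3 x y z.
Proof. by rewrite /det3 !vecE; ring. Qed.

Lemma det3_rot x y z : det3 y z x = det3 x y z.
Proof. by rewrite /det3 !vecE; ring. Qed.

Lemma dotp0l x : dotp 0 x = 0.
Proof. by rewrite !vecE; ring. Qed.

Lemma dotpNl x y : dotp (- x) y = - dotp x y.
Proof. by rewrite !vecE; ring. Qed.

Lemma dotpNr x y : dotp x (- y) = - dotp x y.
Proof. by rewrite !vecE; ring. Qed.

Lemma crossp0l x : crossp 0 x = 0.
Proof. by apply: vec3P; rewrite !vecE; ring. Qed.

Lemma crossp0r x : crossp x 0 = 0.
Proof. by apply: vec3P; rewrite !vecE; ring. Qed.

Lemma crosspp x : crossp x x = 0.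
Proof. by apply: vec3P; rewrite !vecE; ring. Qed.

Lemma crosspC x y : crossp y x = - crossp x y.
Proof. by apply: vec3P; rewrite !vecE; ring. Qed.

Lemma crosspZl s x y : crossp (s *: x) y = s *: crossp x y.
Proof. by apply: vec3P; rewrite !vecE; ring. Qed.

Lemma crosspDl x y z : crossp (x + y) z = crossp x z + crossp y z.
Proof. by apply: vec3P; rewrite !vecE; ring. Qed.

Lemma crosspZr s x y : crossp y (s *: x) = s *: crossp y x.
Proof. by apply: vec3P; rewrite !vecE; ring. Qed.

Lemma dotp_crossp2 x y v w :
  dotp (crossp x y) (crossp v w) = dotp x v * dotp y w - dotp x w * dotp y v.
Proof. by rewrite !vecE; ring. Qed.

Lemma crossp_eq0_parallel x a : crossp x a = 0 -> dotp a a *: x = dotp x a *: a.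
Proof.
move=> xa; apply/eqP; rewrite -subr_eq0; apply/eqP.
transitivity (crossp a (crossp x a)); last by rewrite xa crossp0r.
by apply: vec3P; rewrite !vecE; ring.
Qed.

Lemma plane_crossp n v w : dotp n v = 0 -> dotp n w = 0 ->
  dotp n n *: crossp v w = det3 n v w *: n.
Proof.
move=> nv nw.
transitivity (det3 n v w *: n + dotp n v *: crossp n w - dotp n w *: crossp n v).
  by rewrite /det3; apply: vec3P; rewrite !vecE; ring.
by rewrite nv nw !scale0r subr0 addr0.
Qed.

Lemma dotp_sumr (I : finType) (P : pred I) (v : I -> 'cV[R]_3) x :
  dotp x (\sum_(k | P k) v k) = \sum_(k | P k) dotp x (v k).
Proof.
by apply: (big_morph (dotp x)) => [y z|]; [exact: dotpDr|exact: dotp0r].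
Qed.

End Vectors.

(** * A nonnegative basis yields one that contains a facet normal *)

Section Extremal.
Variables (R : realType) (I : finType) (P : pred I) (f g : I -> R) (i0 : I).

(** For plane vectors (f k, g k) with f k > 0, an angularly extreme one: it has
least slope g k / f k. *)
Lemma ratio_extremal : P i0 -> (forall k, P k -> 0 < f k) ->
  exists2 i, P i & forall k, P k -> 0 <= f i * g k - g i * f k.
Proof.
move=> Pi0 f0; case: (arg_minP (fun k => g k / f k) Pi0) => i Pi imin.
exists i => // k Pk; have fi := f0 _ Pi; have fk := f0 _ Pk.
have := imin k Pk.
by rewrite ler_pdivrMr // mulrAC ler_pdivlMr // subr_ge0 [f i * _]mulrC.
Qed.

End Extremal.

Section Ray.
Variables (R : realType) (I : finType) (l : I -> 'cV[R]_3) (x d : 'cV[R]_3).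
Hypothesis x_in : forall k, 0 <= dotp (l k) x.
Hypothesis tight : forall k, dotp (l k) x = 0 -> dotp (l k) d = 0.

(** Moving along d from a point of a polyhedral cone, as far as the cone allows,
keeps the tight constraints tight and makes a further one tight. The number of
slack constraints is the measure on which exists_facet proceeds by induction. *)
Lemma ray_exit k : dotp (l k) d < 0 ->
  exists t : R, [/\ 0 < t, forall k, 0 <= dotp (l k) (x + t *: d) &
    (#|[pred k | (0 < dotp (l k) (x + t *: d))%R]|
     < #|[pred k | (0 < dotp (l k) x)%R]|)%N].
Proof.
move=> ldk.
have tpos j : dotp (l j) d < 0 -> 0 < dotp (l j) x.
  by move=> ldj; rewrite lt0r x_in andbT; apply: contraTneq ldj => /tight ->;
    rewrite ltxx.
case: (arg_minP (P := fun j => dotp (l j) d < 0)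
  (fun j => dotp (l j) x / - dotp (l j) d) ldk) => j ldj jmin.
set t := dotp (l j) x / - dotp (l j) d in jmin.
have t0 : 0 < t by rewrite divr_gt0 ?oppr_gt0 ?tpos.
have jt : dotp (l j) (x + t *: d) = 0.
  by rewrite dotpDr dotpZr /t; field; rewrite lt_eqF.
exists t; split => // [i|].
  rewrite dotpDr dotpZr; case: (ltP (dotp (l i) d) 0) => ldi.
    have := jmin i ldi; rewrite ler_pdivlMr ?oppr_gt0 // mulrN.
    by rewrite -subr_ge0 opprK.
  by rewrite addr_ge0 // mulr_ge0 // ltW.
apply: proper_card; apply/properP; split.
  apply/fintype.subsetP => i; rewrite !inE => h.
  rewrite lt0r x_in andbT; apply: contraTneq h => e.
  by rewrite dotpDr dotpZr e tight // mulr0 addr0 ltxx.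
by exists j; rewrite !inE ?jt ?ltxx // tpos.
Qed.

End Ray.

Section FacetNormal.
Variables (R : realType) (p : nat) (u : 'I_p -> 'cV[R]_3).
Hypothesis u_neq0 : forall k, u k != 0.
Hypothesis u_ge0 : forall k i, 0 <= u k i 0.

Let s : 'cV[R]_3 := \sum_k u k.

(** The polar form, doubled, of x |-> (x * a).(x * b). That quadratic form has
signature (+, +, -) when a and b are not parallel; it is nonnegative where the
projections of a and b along x do not make an obtuse angle. *)
Definition qform (a b x y : 'cV[R]_3) : R :=
  dotp a b * dotp x y *+ 2 - dotp x a * dotp y b - dotp x b * dotp y a.

Lemma qformE a b x : qform a b x x = dotp (crossp x a) (crossp x b) *+ 2.
Proof. by rewrite /qform !vecE; ring. Qed.

Lemma dotp_cauchy (x y : 'cV[R]_3) : dotp x y ^+ 2 <= dotp x x * dotp y y.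
Proof. by rewrite -subr_ge0 -dotp_crossp dotp_ge0. Qed.

(** Convexity of the cone q < 0 inside the half spaces bounded by a and b. Its
inequality on the diagonal is (a.b) |x|^2 <= (x.a)(x.b), so Cauchy-Schwarz
bounds (a.b)(x.y) by the geometric mean of (x.a)(y.b) and (x.b)(y.a), and the
arithmetic mean of these two is larger. *)
Lemma qform_le0 a b x y : 0 <= dotp a b ->
  0 <= dotp x a -> 0 <= dotp x b -> 0 <= dotp y a -> 0 <= dotp y b ->
  qform a b x x <= 0 -> qform a b y y <= 0 -> qform a b x y <= 0.
Proof.
rewrite /qform; move=> c0 xa xb ya yb qx qy.
set c := dotp a b in c0 qx qy *; have cs := dotp_cauchy x y.
have X0 := dotp_ge0 x; have Y0 := dotp_ge0 y.
set P := dotp x a * dotp y b; set Q := dotp x b * dotp y a.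
have P0 : 0 <= P by exact: mulr_ge0.
have Q0 : 0 <= Q by exact: mulr_ge0.
have h : (c * dotp x y) ^+ 2 <= P * Q.
  apply: (@le_trans _ _ ((c * dotp x x) * (c * dotp y y))).
    have -> : c * dotp x x * (c * dotp y y) = c ^+ 2 * (dotp x x * dotp y y).
      by ring.
    by rewrite exprMn ler_wpM2l // sqr_ge0.
  have -> : P * Q = (dotp x a * dotp x b) * (dotp y a * dotp y b).
    by rewrite /P /Q; ring.
  by apply: ler_pM; rewrite ?mulr_ge0 //; lra.
have : (c * dotp x y *+ 2) ^+ 2 <= (P + Q) ^+ 2.
  have : 0 <= (P - Q) ^+ 2 by exact: sqr_ge0.
  by nra.
have [h0|h0] := leP 0 (c * dotp x y); last by lra.
rewrite ler_sqr ?nnegrE ?addr_ge0 ?mulrn_wge0 //.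
by lra.
Qed.

(** The normal n of a plane that supports the cone of the u k in a facet, such
that projecting along n leaves no obtuse angle. The last clause is the
inequality U^T U >= U^T g g^T U with g the unit vector of n, multiplied by the
squared length of n. *)
Definition acute_facet_normal (n : 'cV[R]_3) :=
  [/\ n != 0, forall k, 0 <= dotp n (u k),
   exists i j, [/\ crossp (u i) (u j) != 0, dotp n (u i) = 0
                 & dotp n (u j) = 0] &
   forall k l, dotp n (u k) * dotp n (u l) <= dotp n n * dotp (u k) (u l)].

Section Pair.
Variables a b : 'cV[R]_3.
Hypothesis ab0 : 0 <= dotp a b.
Hypothesis a_in : exists i, u i = a.
Hypothesis b_in : exists i, u i = b.
Hypothesis ab_indep : crossp a b != 0.
Hypothesis spanning : forall n, (forall k, dotp n (u k) = 0) -> n = 0.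

(** The directions x that are nonnegative on all vectors and from which the
projection of every u k lies between those of a and b. *)
Definition in_wedge x := forall k,
  [/\ 0 <= dotp x (u k), 0 <= det3 x a (u k) & 0 <= det3 x (u k) b].

(** The last two conditions exclude the multiples of a and b, which lie on the
boundary of the cone q < 0 without giving a frame. *)
Definition admissible x :=
  [/\ in_wedge x, 0 <= qform a b x x, crossp x a != 0 & crossp x b != 0].

Definition constraint (k : 'I_p * 'I_3) : 'cV[R]_3 :=
  if k.2 == 0 then u k.1 else
  if k.2 == 1 then crossp a (u k.1) else crossp (u k.1) b.

Lemma in_wedgeP x : in_wedge x <-> forall k, 0 <= dotp (constraint k) x.
Proof.
split=> [h [k [[|[|[|//]]] m]]|h k]; rewrite /constraint /=.
- by rewrite dotpC; case: (h k).
- by rewrite dotpC; case: (h k).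
- by rewrite dotpC; case: (h k).
split; [have := h (k, 0)|have := h (k, 1)|have := h (k, 1+1)];
  by rewrite dotpC.
Qed.

Lemma spanning_neq0 (n : 'cV[R]_3) : n != 0 -> exists k, dotp n (u k) != 0.
Proof.
move=> n0; apply: contrapT => /forallNP h; case/negP: n0; apply/eqP.
by apply: spanning => k; have /negP/negPn/eqP := h k.
Qed.

(** If x, a and b were coplanar, x * b would be a multiple of x * a, nonnegative
because q x >= 0, while the wedge conditions ask for opposite signs on every
u k; the u k would then span no more than a plane. *)
Lemma admissible_det3_gt0 (x : 'cV[R]_3) : admissible x -> 0 < det3 x a b.
Proof.
case=> xw q0 xa xb; case: b_in => j ujb; have [_ + _] := xw j.
rewrite ujb lt0r => -> /[!andbT]; apply/eqP => D0.
have [k /eqP[]] := spanning_neq0 xb.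
have [_ na nb] := xw k.
rewrite det3_crossp in na; rewrite det3C det3_crossp oppr_ge0 in nb.
rewrite qformE pmulrn_lge0 // in q0.
have xa0 : 0 < dotp (crossp x a) (crossp x a) by rewrite dotp_gt0.
apply/eqP; rewrite eq_le nb /= -(pmulr_rge0 _ xa0).
have -> : dotp (crossp x a) (crossp x a) * dotp (crossp x b) (u k) =
  dotp (crossp x a) (crossp x b) * dotp (crossp x a) (u k) +
  det3 x a b * dotp x (crossp (crossp x a) (u k)).
  by rewrite /det3 !vecE; ring.
by rewrite D0 mul0r addr0 mulr_ge0.
Qed.

(** Every projection is a nonnegative combination of the projections of a and b,
which do not make an obtuse angle. *)
Lemma admissible_acute (x : 'cV[R]_3) : admissible x ->
  forall k l, 0 <= dotp (crossp x (u k)) (crossp x (u l)).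
Proof.
move=> xadm k l; have D0 := admissible_det3_gt0 xadm.
case: xadm => xw q0 _ _; rewrite qformE pmulrn_lge0 // in q0.
have decomp m : det3 x a b *: crossp x (u m) =
    det3 x (u m) b *: crossp x a + det3 x a (u m) *: crossp x b.
  by rewrite /det3; apply: vec3P; rewrite !vecE; ring.
rewrite -(pmulr_rge0 _ D0) -(pmulr_rge0 _ D0) mulrCA -dotpZl -dotpZr !decomp.
rewrite !(dotpDl, dotpDr, dotpZl, dotpZr) [dotp (crossp x b) (crossp x a)]dotpC.
have [_ A0 B0] := xw k; have [_ A1 B1] := xw l.
by rewrite !(addr_ge0, mulr_ge0) // dotp_ge0.
Qed.

Lemma admissible_neq0 (x : 'cV[R]_3) : admissible x -> x != 0.
Proof. by case=> _ _ + _; apply: contraNneq => ->; rewrite crossp0l. Qed.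

(** In the orthogonal frame of x, n = x * c and x * n, the vectors v and w have
coordinates of equal sign along x and along x * n. Hence their projections
along n do not make an obtuse angle. *)
Lemma acute_crossp (x c v w : 'cV[R]_3) : x != 0 ->
  0 <= dotp x v -> 0 <= dotp x w ->
  0 <= dotp (crossp x c) (crossp x v) -> 0 <= dotp (crossp x c) (crossp x w) ->
  dotp (crossp x c) v * dotp (crossp x c) w <=
  dotp (crossp x c) (crossp x c) * dotp v w.
Proof.
rewrite -dotp_gt0 => x0 xv xw cv cw.
rewrite -subr_ge0 -(pmulr_rge0 _ x0).
set n := crossp x c.
have -> : dotp x x * (dotp n n * dotp v w - dotp n v * dotp n w) =
  dotp n n * (dotp x v * dotp x w)
  + dotp (crossp x c) (crossp x v) * dotp (crossp x c) (crossp x w).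
  by rewrite /n !vecE; ring.
by rewrite addr_ge0 ?mulr_ge0 // dotp_ge0.
Qed.

Lemma facet_self (x : 'cV[R]_3) k l : admissible x -> crossp (u k) (u l) != 0 ->
  dotp x (u k) = 0 -> dotp x (u l) = 0 -> acute_facet_normal x.
Proof.
move=> xadm kl xk xl; split; first exact: admissible_neq0.
- by move=> m; case: xadm => /(_ m)[].
- by exists k, l.
move=> i j; have := admissible_acute xadm i j.
by rewrite dotp_crossp2 subr_ge0 [dotp (u i) x]dotpC mulrC [_ * dotp _ _]mulrC.
Qed.

(** A tight constraint det3 x a (u k) = 0 puts u k into the plane of x and a. The
normal x * a of this plane belongs to the nonnegative frame that starts with x. *)
Lemma facet_left (x : 'cV[R]_3) k : admissible x -> crossp a (u k) != 0 ->
  det3 x a (u k) = 0 -> acute_facet_normal (crossp x a).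
Proof.
move=> xadm ak D0; case: a_in => i uia; have acute := admissible_acute xadm.
have x0 := admissible_neq0 xadm; case: (xadm) => xw _ xa xb.
split=> // [m||m l].
- by rewrite -det3_crossp; case: (xw m).
- exists i, k; rewrite uia -!det3_crossp; split=> //.
  by rewrite /det3 crosspp dotp0r.
- case: (xw m) => ? _ _; case: (xw l) => ? _ _.
  by apply: acute_crossp; rewrite // -uia acute.
Qed.

Lemma facet_right (x : 'cV[R]_3) k : admissible x -> crossp (u k) b != 0 ->
  det3 x (u k) b = 0 -> acute_facet_normal (- crossp x b).
Proof.
move=> xadm ak D0; case: b_in => i uib; have acute := admissible_acute xadm.
have x0 := admissible_neq0 xadm; case: (xadm) => xw _ xa xb.
split=> [|m||m l]; first by rewrite oppr_eq0.
- by rewrite dotpNl -det3_crossp -det3C; case: (xw m).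
- exists k, i; rewrite uib !dotpNl -!det3_crossp -!det3C; split=> //.
  by rewrite /det3 crosspp dotp0r.
- case: (xw m) => ? _ _; case: (xw l) => ? _ _.
  rewrite !dotpNl dotpNr mulrNN opprK.
  by apply: acute_crossp; rewrite // -uib acute.
Qed.

(** As long as no facet normal is at hand, the tight constraints are all multiples
of a single vector c: two independent ones make x, x * a or x * b such a
normal. The vector s * c is then a direction along which all of them remain
tight, and moving along it keeps the product with s constant, which makes the
motion bounded. *)
Lemma free_direction (x : 'cV[R]_3) : admissible x ->
  (forall n, ~ acute_facet_normal n) ->
  exists d : 'cV[R]_3, [/\ d != 0, dotp d s = 0 &
    forall k, dotp (constraint k) x = 0 -> dotp (constraint k) d = 0].
Proof.
move=> xadm nf; have x0 := admissible_neq0 xadm; case: (xadm) => xw _ _ _.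
have sx : 0 < dotp x s.
  rewrite dotp_sumr lt0r sumr_ge0 ?andbT => [|k _]; last by case: (xw k).
  have [k] := spanning_neq0 x0; apply: contraNneq => /eqP.
  rewrite psumr_eq0 => [/allP/(_ k)|i _]; last by case: (xw i).
  by rewrite mem_index_enum => /(_ isT).
have s0 : s != 0 by apply: contraTneq sx => ->; rewrite dotp0r ltxx.
have [c [sc0 cP]] : exists c : 'cV[R]_3, crossp s c != 0 /\
    (forall k, dotp x (u k) = 0 -> crossp c (u k) = 0).
  have [[k0 xk0]|nt] := pselect (exists k, dotp x (u k) = 0).
    exists (u k0); split=> [|k xk].
      apply: contraTneq sx => e; rewrite -leNgt.
      have := dotp_crossp2 s (u k0) x (u k0).
      rewrite e dotp0l [dotp _ x]dotpC [dotp (u k0) x]dotpC xk0 mulr0 subr0.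
      move/esym/eqP.
      by rewrite mulf_eq0 dotp_eq0 (negbTE (u_neq0 _)) orbF => /eqP ->.
    by apply/eqP/negPn/negP => h; case: (nf x (facet_self xadm h xk0 xk)).
  have [sa|sa] := eqVneq (crossp s a) 0; last first.
    by exists a; split=> // k xk; case: nt; exists k.
  have [sb|sb] := eqVneq (crossp s b) 0; last first.
    by exists b; split=> // k xk; case: nt; exists k.
  case/negP: ab_indep; have : dotp s s *: crossp a b = 0.
    transitivity (dotp (crossp s a) b *: s - dotp s b *: crossp s a
      + dotp s a *: crossp s b).
      by apply: vec3P; rewrite !vecE; ring.
    by rewrite sa sb dotp0l scale0r !scaler0 subr0 addr0.
  by move/eqP; rewrite scaler_eq0 dotp_eq0 (negbTE s0).
exists (crossp s c); split=> //.
  by rewrite dotpC /dotp -/(dotp _ _) -/(det3 s s c) det3_crossp crosspp dotp0l.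
move=> [k [[|[|[|//]]] m]]; rewrite /constraint /= => /eqP; rewrite dotpC => /eqP tk.
- by rewrite dotpC -det3_crossp /det3 cP // dotp0r.
- have [->|/facet_left h] := eqVneq (crossp a (u k)) 0; first by rewrite dotp0l.
  by case: (nf _ (h _ xadm tk)).
- have [->|/facet_right h] := eqVneq (crossp (u k) b) 0; first by rewrite dotp0l.
  by case: (nf _ (h _ xadm tk)).
Qed.

Lemma inadmissible_le0 (x : 'cV[R]_3) : in_wedge x -> ~ admissible x ->
  qform a b x x <= 0 /\
  (qform a b x x = 0 -> crossp x a = 0 \/ crossp x b = 0).
Proof.
move=> xw nadm; have [xa|xa] := eqVneq (crossp x a) 0.
  by rewrite qformE xa dotp0l mul0rn; split; [|left].
have [xb|xb] := eqVneq (crossp x b) 0.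
  by rewrite qformE xb dotp0r mul0rn; split; [|right].
have q0 : qform a b x x < 0 by rewrite ltNge; apply/negP => ?; apply: nadm.
by split=> [|e]; [exact: ltW|rewrite e ltxx in q0].
Qed.

(** Here y and z are multiples of a and b, and on the pair (a, b) itself the polar
form is - |a * b|^2. *)
Lemma qform_neq0 (y z : 'cV[R]_3) : y != 0 -> z != 0 ->
  crossp y a = 0 -> crossp z b = 0 -> qform a b y z != 0.
Proof.
move=> y0 z0 /crossp_eq0_parallel ya /crossp_eq0_parallel zb.
have a0 : a != 0 by apply: contraNneq ab_indep => ->; rewrite crossp0l.
have b0 : b != 0 by apply: contraNneq ab_indep => ->; rewrite crossp0r.
have ya0 : dotp y a != 0.
  apply: contraNneq y0 => e; move: ya; rewrite e scale0r => /eqP.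
  by rewrite scaler_eq0 dotp_eq0 (negbTE a0).
have zb0 : dotp z b != 0.
  apply: contraNneq z0 => e; move: zb; rewrite e scale0r => /eqP.
  by rewrite scaler_eq0 dotp_eq0 (negbTE b0).
have : dotp a a * dotp b b * qform a b y z =
    - (dotp y a * dotp z b * dotp (crossp a b) (crossp a b)).
  transitivity (qform a b (dotp a a *: y) (dotp b b *: z)).
    by rewrite /qform !vecE; ring.
  by rewrite ya zb /qform !vecE; ring.
move=> e; apply/eqP => q0; move/eqP: e; rewrite q0 mulr0 eq_sym oppr_eq0.
by rewrite !mulf_eq0 dotp_eq0 (negbTE ya0) (negbTE zb0) (negbTE ab_indep).
Qed.

Lemma qformC (x y : 'cV[R]_3) : qform a b x y = qform a b y x.
Proof. by rewrite /qform [dotp x y]dotpC; ring. Qed.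

Lemma qform_comb (y z : 'cV[R]_3) (t t' : R) :
  qform a b (t' *: y + t *: z) (t' *: y + t *: z) =
  t' ^+ 2 * qform a b y y + t ^+ 2 * qform a b z z
  + t' * t * qform a b y z *+ 2.
Proof. by rewrite /qform !vecE; ring. Qed.

(** Otherwise q <= 0 at both ends y and z. Since x is a positive combination of
them and q x >= 0, convexity forces q to vanish at y, at z and at the pair
(y, z). Then y and z are multiples of a and b: of the same one, and so is x, or
of both, where the polar form does not vanish. *)
Lemma admissible_between (x d : 'cV[R]_3) (t t' : R) :
  admissible x -> dotp d s = 0 -> 0 < dotp x s -> 0 < t -> 0 < t' ->
  in_wedge (x + t *: d) -> in_wedge (x + t' *: - d) ->
  admissible (x + t *: d) \/ admissible (x + t' *: - d).
Proof.
move=> [_ qx xa xb] ds xs t0 t'0; set y := x + _; set z := x + t' *: _ => yw zw.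
apply: contrapT => /not_orP[/inadmissible_le0 ny /inadmissible_le0 nz].
have {ny} [qy ye] := ny yw; have {nz} [qz ze] := nz zw.
have mean : (t' + t) *: x = t' *: y + t *: z.
  by rewrite /y /z; apply: vec3P; rewrite !vecE; ring.
have tt : t' + t != 0 by rewrite gt_eqF // addr_gt0.
have dot0 (w : 'cV[R]_3) : in_wedge w -> 0 <= dotp w a /\ 0 <= dotp w b.
  move=> ww; case: a_in b_in => i <- [j <-].
  by split; [case: (ww i)|case: (ww j)].
have [? ?] := dot0 y yw; have [? ?] := dot0 z zw.
have qyz : qform a b y z <= 0 by exact: qform_le0.
have expand : (t' + t) ^+ 2 * qform a b x x = t' ^+ 2 * qform a b y y
    + t ^+ 2 * qform a b z z + t' * t * qform a b y z *+ 2.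
  transitivity (qform a b ((t' + t) *: x) ((t' + t) *: x)).
    by rewrite /qform !(dotpZl, dotpZr); ring.
  by rewrite mean qform_comb.
have : 0 <= (t' + t) ^+ 2 * qform a b x x by rewrite mulr_ge0 ?sqr_ge0.
have t2 : 0 < t ^+ 2 by rewrite exprn_gt0.
have t'2 : 0 < t' ^+ 2 by rewrite exprn_gt0.
have ttp : 0 < t' * t by rewrite mulr_gt0.
have y1 : t' ^+ 2 * qform a b y y <= 0 by rewrite pmulr_rle0.
have z1 : t ^+ 2 * qform a b z z <= 0 by rewrite pmulr_rle0.
have yz1 : t' * t * qform a b y z <= 0 by rewrite pmulr_rle0.
rewrite expand => sum0.
have /ye yab : qform a b y y = 0.
  by apply/eqP; rewrite eq_le qy -(pmulr_rge0 _ t'2) /=; lra.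
have /ze zab : qform a b z z = 0.
  by apply/eqP; rewrite eq_le qz -(pmulr_rge0 _ t2) /=; lra.
have qyz0 : qform a b y z = 0.
  by apply/eqP; rewrite eq_le qyz -(pmulr_rge0 _ ttp) /=; lra.
have yn : y != 0.
  apply: contraTneq xs => e; have := dotpDl s x (t *: d).
  by rewrite -/y e dotp0l dotpZl ds mulr0 addr0 => <-; rewrite ltxx.
have zn : z != 0.
  apply: contraTneq xs => e; have := dotpDl s x (t' *: - d).
  by rewrite -/z e dotp0l dotpZl dotpNl ds oppr0 mulr0 addr0 => <-; rewrite ltxx.
have xc c : crossp y c = 0 -> crossp z c = 0 -> crossp x c = 0.
  move=> yc zc; have : (t' + t) *: crossp x c = 0.
    by rewrite -crosspZl mean crosspDl !crosspZl yc zc !scaler0 addr0.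
  by move/eqP; rewrite scaler_eq0 (negbTE tt) => /eqP.
case: zab yab => [za|zb] [ya|yb].
- by rewrite xc ?eqxx in xa.
- by have /eqP := qform_neq0 zn yn za yb; apply; rewrite qformC.
- by have /eqP := qform_neq0 yn zn ya zb.
- by rewrite xc ?eqxx in xb.
Qed.

Lemma exists_facet (x : 'cV[R]_3) : admissible x -> exists n, acute_facet_normal n.
Proof.
have [m] := ubnP #|[pred k | (0 < dotp (constraint k) x)%R]|.
elim: m x => // m IH x; rewrite ltnS => xm xadm.
apply: contrapT => /forallNP nf.
have [d [d0 ds dt]] := free_direction xadm nf.
have exit e : e != 0 -> dotp e s = 0 -> exists k, dotp (constraint k) e < 0.
  move=> e0 es; apply: contrapT => /forallNP h.
  have eu k : 0 <= dotp e (u k).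
    by rewrite dotpC leNgt; apply/negP => ek; apply: (h (k, 0)).
  have [k] := spanning_neq0 e0; move/eqP: es; rewrite dotp_sumr psumr_eq0 //.
  by move/allP/(_ k); rewrite mem_index_enum => /(_ isT) /= ->.
have xw : forall k, 0 <= dotp (constraint k) x by apply/in_wedgeP; case: xadm.
have xs : 0 < dotp x s.
  rewrite dotp_sumr lt0r sumr_ge0 ?andbT => [|k _]; last first.
    by case: xadm => /(_ k)[].
  have [k] := spanning_neq0 (admissible_neq0 xadm); apply: contraNneq => /eqP.
  rewrite psumr_eq0 => [/allP/(_ k)|i _]; last by case: xadm => /(_ i)[].
  by rewrite mem_index_enum => /(_ isT).
have [k1 lk1] := exit _ d0 ds.
have [k2 lk2] : exists k, dotp (constraint k) (- d) < 0.
  by apply: exit; rewrite ?oppr_eq0 // dotpNl ds oppr0.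
(* The motion is bounded in both directions because d and - d are orthogonal to
the sum of all vectors. *)
have [t [t0 /in_wedgeP yw yc]] := ray_exit xw dt lk1.
have [|t' [t'0 /in_wedgeP zw zc]] := ray_exit xw _ lk2.
  by move=> k /dt; rewrite dotpNr => ->; rewrite oppr0.
have [] := admissible_between xadm ds xs t0 t'0 yw zw => /IH h.
- by case: (h (leq_trans yc xm)) => n /nf.
- by case: (h (leq_trans zc xm)) => n /nf.
Qed.

End Pair.

(** The start of the motion is the first basis vector, with a and b the angularly
extreme vectors as seen from it. Vectors that only span a plane are treated
apart: the normal of that plane already serves. *)
Lemma parallel_or_acute_facet :
  (forall i j, crossp (u i) (u j) = 0) \/ exists n, acute_facet_normal n.
Proof.
have dotu i j : 0 <= dotp (u i) (u j) by rewrite dotpE !addr_ge0 // mulr_ge0.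
have [par|npar] := pselect (forall i j, crossp (u i) (u j) = 0); [by left|right].
have {npar} [i [j uij]] : exists i j, crossp (u i) (u j) != 0.
  apply: contrapT => h; apply: npar => i j; apply/eqP/negPn/negP => ij.
  by apply: h; exists i, j.
have [[n n0 nu]|flat] := pselect (exists2 n : 'cV[R]_3, n != 0 &
    forall k, dotp n (u k) = 0).
  exists n; split=> //; first by move=> k; rewrite nu.
    by exists i, j.
  by move=> k l; rewrite !nu mul0r mulr_ge0 // dotp_ge0.
have spanning (n : 'cV[R]_3) : (forall k, dotp n (u k) = 0) -> n = 0.
  by move=> nu; apply/eqP/negPn/negP => n0; apply: flat; exists n.
pose e1 : 'cV[R]_3 := mkvec 1 0 0.
(* The functional that serves to compare slopes in the projection along e1; it is
positive on all nonzero projections because they lie in the first quadrant. *)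
pose f k := u k i1 0 + u k i2 0.
have f_ge0 k : 0 <= f k by rewrite addr_ge0.
have f0 k : ~~ (0 < f k) -> u k i1 0 = 0 /\ u k i2 0 = 0.
  rewrite lt0r f_ge0 andbT negbK paddr_eq0 //.
  by case/andP => /eqP-> /eqP->.
have [k0 fk0] : exists k0, 0 < f k0.
  apply: contrapT => /forallNP h.
  have /eqP : mkvec 0 1 0 = 0 :> 'cV[R]_3.
    apply: spanning => k; have /negP/f0[e _] := h k.
    by rewrite !vecE e; ring.
  apply/negP/eqP => /(congr1 (fun v : 'cV[R]_3 => v i1 0)).
  by rewrite !vecE => /eqP; rewrite oner_eq0.
pose ratio := ratio_extremal (P := fun k => 0 < f k).
have [ia fa aP] := ratio _ f (fun k => u k i2 0) _ fk0 (fun k => id).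
have [ib fb bP] := ratio _ f (fun k => u k i1 0) _ fk0 (fun k => id).
have e1a k : det3 e1 (u ia) (u k) = f ia * u k i2 0 - u ia i2 0 * f k.
  by rewrite /det3 /f !vecE; ring.
have e1b k : det3 e1 (u k) (u ib) = f ib * u k i1 0 - u ib i1 0 * f k.
  by rewrite /det3 /f !vecE; ring.
have e1n k : 0 < f k -> crossp e1 (u k) != 0.
  apply: contraTneq => e; rewrite -leNgt.
  have := congr1 (fun v : 'cV[R]_3 => v i1 0) e.
  have := congr1 (fun v : 'cV[R]_3 => v i2 0) e.
  by rewrite /f !vecE; lra.
have wedge : in_wedge (u ia) (u ib) e1.
  move=> k; rewrite e1a e1b; split.
  - by rewrite !vecE !mul0r !addr0 mul1r.
  - have [/aP//|/f0[e e']] := boolP (0 < f k).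
    by rewrite /f e e' addr0 !mulr0 subrr.
  - have [/bP//|/f0[e e']] := boolP (0 < f k).
    by rewrite /f e e' addr0 !mulr0 subrr.
apply: (@exists_facet (u ia) (u ib) _ _ _ _ _ e1) => //; try by eexists.
  apply/eqP => ab.
  have/crossp_eq0_parallel ba : crossp (u ib) (u ia) = 0 by rewrite crosspC ab oppr0.
  have ab0 : 0 < dotp (u ib) (u ia).
    rewrite lt0r dotu andbT; apply: contraTneq isT => e; move/eqP: ba.
    by rewrite e scale0r scaler_eq0 dotp_eq0 !(negbTE (u_neq0 _)).
  have /eqP[] := e1n _ fa; apply: spanning => k.
  have [_ A B] := wedge k; apply/eqP; rewrite eq_le -det3_crossp A andbT.
  rewrite -(pmulr_rle0 _ ab0) -oppr_ge0.
  have -> : - (dotp (u ib) (u ia) * det3 e1 (u ia) (u k)) =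
     det3 e1 (u k) (dotp (u ib) (u ia) *: u ia) by rewrite /det3 !vecE; ring.
  rewrite -ba.
  have -> : det3 e1 (u k) (dotp (u ia) (u ia) *: u ib) =
     dotp (u ia) (u ia) * det3 e1 (u k) (u ib) by rewrite /det3 !vecE; ring.
  by rewrite mulr_ge0 // dotp_ge0.
split=> //; try exact: e1n.
have -> : qform (u ia) (u ib) e1 e1 =
    (u ia i1 0 * u ib i1 0 + u ia i2 0 * u ib i2 0) *+ 2.
  by rewrite qformE !vecE; ring.
by rewrite mulrn_wge0 // addr_ge0 // mulr_ge0.
Qed.

End FacetNormal.

Section Transfer.
Variables (R : realType) (p : nat) (U : 'M[R]_(3, p)).

(** All notions in the conclusion are expressed by inner products, so they are
invariant under the rotation that maps F to the standard basis. *)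
Lemma nonneg_basis_acute_facet (F : 'M[R]_3) : nonzero_cols U -> nonneg_basis U F ->
  (forall i j, crossp (col i U) (col j U) = 0) \/
  exists n, acute_facet_normal (fun k => col k U) n.
Proof.
move=> U0 [Fo FU]; have Fo' := mulmx1C Fo.
pose u k : 'cV[R]_3 := F^T *m col k U.
have dotF x y : dotp (F^T *m x) (F^T *m y) = dotp x y.
  by rewrite /dotp trmx_mul trmxK !mulmxA -[x^T *m F *m F^T]mulmxA Fo' mulmx1.
have dotF' x y : dotp (F *m x) y = dotp x (F^T *m y).
  by rewrite -dotF mulmxA Fo mul1mx.
have crossF i j : (crossp (u i) (u j) == 0) =
    (crossp (col i U) (col j U) == 0).
  by rewrite -!dotp_eq0 !dotp_crossp !dotF.
have [||par|[n [n0 nu [i [j [ij ni nj]]] good]]] := @parallel_or_acute_facet R p u.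
- move=> k; apply: contraNneq (U0 k) => /(congr1 (mulmx F)).
  by rewrite mulmxA Fo' mul1mx mulmx0 => ->.
- move=> k i; have := FU i k; rewrite /u !mxE.
  by congr (_ <= _); apply: eq_bigr => l _; rewrite [col _ _ _ _]mxE.
- by left=> i j; apply/eqP; rewrite -crossF par.
- right; exists (F *m n); split.
  + by rewrite -dotp_eq0 dotF' mulmxA Fo mul1mx dotp_eq0.
  + by move=> k; rewrite dotF'; apply: nu.
  + by exists i, j; rewrite !dotF' -crossF.
  + move=> k l; rewrite !dotF' mulmxA Fo mul1mx -(dotF (col k U)).
    exact: good.
Qed.

End Transfer.

(** * The spherical convex hull, its vertices and its boundary *)

Section Sphere.
Variable R : realType.
Implicit Types (x y z v w n h c : 'cV[R]_3).

Lemma sphereP x : sphere x <-> dotp x x = 1.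
Proof.
rewrite /sphere /= /enorm; split=> [e|->]; last exact: sqrtr1.
by rewrite -[LHS]sqr_sqrtr ?dotp_ge0 // e expr1n.
Qed.

Lemma enorm_gt0 x : (0 < enorm x) = (x != 0).
Proof. by rewrite /enorm sqrtr_gt0 dotp_gt0. Qed.

Lemma sproj_sphere x : x != 0 -> sphere (sproj x).
Proof.
move=> x0; apply/sphereP; rewrite /sproj dotpZl dotpZr mulrA -invfM -expr2.
by rewrite /enorm sqr_sqrtr ?dotp_ge0 // mulVf // dotp_eq0.
Qed.

Lemma sproj_id x : sphere x -> sproj x = x.
Proof. by rewrite /sphere /= /sproj => ->; rewrite invr1 scale1r. Qed.

Lemma dotp_sproj_ge0 c x : x != 0 -> (0 <= dotp c (sproj x)) = (0 <= dotp c x).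
Proof. by move=> x0; rewrite dotpZr pmulr_rge0 // invr_gt0 enorm_gt0. Qed.

Lemma dotp_sproj_gt0 c x : x != 0 -> (0 < dotp c (sproj x)) = (0 < dotp c x).
Proof. by move=> x0; rewrite dotpZr pmulr_rgt0 // invr_gt0 enorm_gt0. Qed.

Lemma dotp_sproj_eq0 c x : x != 0 -> (dotp c (sproj x) == 0) = (dotp c x == 0).
Proof.
by move=> x0; rewrite dotpZr mulf_eq0 invr_eq0 gt_eqF // enorm_gt0.
Qed.

Lemma arcP x y z : Defs.arc x y z <-> exists s t : R,
  [/\ 0 <= s, 0 <= t, s *: x + t *: y = z & sphere z].
Proof.
split=> [[s [t [s0 t0 xy ->]]]|[s [t [s0 t0 <- zS]]]].
  exists ((enorm (s *: x + t *: y))^-1 * s), ((enorm (s *: x + t *: y))^-1 * t).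
  rewrite !mulr_ge0 ?invr_ge0 ?sqrtr_ge0 //; split=> //.
    by rewrite -!scalerA -scalerDr.
  exact: sproj_sphere.
exists s, t; split=> //; last by rewrite sproj_id.
apply/eqP => e; move/sphereP: zS; rewrite e dotp0r => /eqP.
by rewrite eq_sym oner_eq0.
Qed.

Lemma halfsphere_convex c : sph_convex [set z | sphere z /\ 0 <= dotp c z].
Proof.
split=> [z []//|x y [xS xc] [yS yc] z /arcP[s [t [s0 t0 <- zS]]]]; split=> //.
by rewrite dotpDr !dotpZr addr_ge0 // mulr_ge0.
Qed.

Lemma open_halfsphere_convex c :
  sph_convex [set z | sphere z /\ 0 < dotp c z].
Proof.
split=> [z []//|x y [xS xc] [yS yc] z /arcP[s [t [s0 t0 <- zS]]]]; split=> //.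
rewrite dotpDr !dotpZr; move: s0; rewrite le_eqVlt => /predU1P[s0|s0].
  rewrite -s0 mul0r add0r mulr_gt0 // lt0r t0 andbT.
  apply: contraTneq isT => t00; move/sphereP: zS.
  by rewrite -s0 t00 !scale0r addr0 dotp0r => /eqP; rewrite eq_sym oner_eq0.
by rewrite ltr_wpDr ?mulr_gt0 // mulr_ge0 // ltW.
Qed.

Lemma sphere_convex : sph_convex (@sphere R).
Proof. by split=> // x y xS yS z /arcP[s [t []]]. Qed.

(** The functional h excludes antipodal points. *)
Lemma sphere_parallel h x y : sphere x -> sphere y ->
  0 < dotp h x -> 0 < dotp h y -> crossp x y = 0 -> x = y.
Proof.
move=> /sphereP xS /sphereP yS hx hy /crossp_eq0_parallel.
rewrite yS scale1r => e; have e1 := congr1 (dotp h) e.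
rewrite dotpZr in e1.
have xy : 0 < dotp x y by rewrite -(pmulr_lgt0 _ hy) -e1.
have := congr1 (dotp x) e; rewrite dotpZr xS -expr2 => /esym/eqP.
by rewrite sqrp_eq1 ?ltW // => /eqP xy1; rewrite e xy1 scale1r.
Qed.

Lemma plane_parallel n v x : n != 0 ->
  dotp n v = 0 -> dotp n x = 0 -> det3 n v x = 0 -> crossp x v = 0.
Proof.
move=> n0 nv nx D0.
have/crossp_eq0_parallel : crossp (crossp x v) n = 0.
  transitivity (dotp n x *: v - dotp n v *: x).
    by apply: vec3P; rewrite !vecE; ring.
  by rewrite nv nx !scale0r subr0.
have -> : dotp (crossp x v) n = - det3 n v x by rewrite /det3 !vecE; ring.
by rewrite D0 oppr0 scale0r => /eqP; rewrite scaler_eq0 dotp_eq0 (negbTE n0) => /eqP.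
Qed.

End Sphere.

Section Hull.
Variables (R : realType) (p : nat) (U : 'M[R]_(3, p)).
Hypothesis U0 : nonzero_cols U.
Implicit Types (x y z v w n h c : 'cV[R]_3).

Local Notation u k := (col k U).
Local Notation P := (proj_hull U).

Lemma proj_hull_gen k : P (sproj (u k)).
Proof. by move=> B _; apply; exists k. Qed.

Lemma proj_hull_min (B : set 'cV[R]_3) :
  sph_convex B -> (forall k, B (sproj (u k))) -> P `<=` B.
Proof. by move=> Bc Bu z Pz; apply: Pz Bc _ => _ [k _ <-]. Qed.

Lemma proj_hull_sphere : P `<=` @sphere R.
Proof.
apply: proj_hull_min (@sphere_convex R) _ => k; exact: sproj_sphere.
Qed.

Lemma proj_hull_arc x y : P x -> P y -> Defs.arc x y `<=` P.
Proof.
by move=> Px Py z xyz B Bc AB; apply: (Bc.2 x y) xyz; [apply: Px|apply: Py].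
Qed.

Lemma proj_hull_ge0 c : (forall k, 0 <= dotp c (u k)) ->
  forall z, P z -> 0 <= dotp c z.
Proof.
move=> cu z; case/(proj_hull_min (halfsphere_convex c)) => // k.
by split; [exact: sproj_sphere|rewrite dotp_sproj_ge0].
Qed.

Lemma proj_hull_gt0 c : (forall k, 0 < dotp c (u k)) ->
  forall z, P z -> 0 < dotp c z.
Proof.
move=> cu z; case/(proj_hull_min (open_halfsphere_convex c)) => // k.
by split; [exact: sproj_sphere|rewrite dotp_sproj_gt0].
Qed.

Section Pointed.
Variable h : 'cV[R]_3.
Hypothesis h_gt0 : forall k, 0 < dotp h (u k).

Lemma hull_parallel x y : P x -> P y -> crossp x y = 0 -> x = y.
Proof.
move=> Px Py; apply: (@sphere_parallel _ h);
  by [exact: proj_hull_sphere|exact: proj_hull_gt0].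
Qed.

(** A vector u i in the facet orthogonal to n that is extreme in the plane of this
facet; r gives the sense in which it is extreme. Tilting n towards
r (n * u i) by a small amount gives a functional that is still nonnegative on
all vectors, so an arc of the hull through u i has both ends on the ray of
u i. *)
Lemma supported_vertex n (r : R) i : n != 0 -> r != 0 ->
  (forall k, 0 <= dotp n (u k)) -> dotp n (u i) = 0 ->
  (forall k, dotp n (u k) = 0 -> 0 <= r * det3 n (u i) (u k)) ->
  hull_vertices U (sproj (u i)).
Proof.
move=> n0 r0 nu ni ext.
set w := r *: crossp n (u i).
have wE z : dotp w z = r * det3 n (u i) z by rewrite dotpZl -det3_crossp.
(* The coefficient of n that makes up for the negative values of w. A summand
with dotp n (u k) = 0 vanishes, by the convention on division by zero. *)
pose N := \sum_k `|dotp w (u k)| / dotp n (u k).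
have n'u k : 0 <= dotp (N *: n + w) (u k).
  rewrite dotpDl dotpZl; have [nk|nk] := eqVneq (dotp n (u k)) 0.
    by rewrite nk mulr0 add0r wE ext.
  have nk0 : 0 < dotp n (u k) by rewrite lt0r nk nu.
  have : `|dotp w (u k)| / dotp n (u k) <= N.
    rewrite /N (bigD1 k) //= lerDl sumr_ge0 // => l _.
    by rewrite divr_ge0.
  rewrite ler_pdivrMr // => le; rewrite -[dotp w _]opprK subr_ge0.
  by apply: le_trans le; rewrite -normrN ler_norm.
set v := sproj (u i); have Pv : P v by exact: proj_hull_gen.
have nv : dotp n v = 0 by apply/eqP; rewrite dotp_sproj_eq0 // ni.
have wv : dotp w v = 0.
  apply/eqP; rewrite dotp_sproj_eq0 // wE /det3 crosspp dotp0r mulr0 //.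
have onray z : P z -> dotp n z = 0 -> dotp w z = 0 -> v = z.
  move=> Pz nz wz; apply/esym/hull_parallel => //.
  apply: plane_parallel n0 nv nz _; move/eqP: wz.
  rewrite wE mulf_eq0 (negbTE r0) /= => /eqP D0.
  rewrite /v /sproj det3_rot -det3_rot /det3.
  transitivity ((enorm (u i))^-1 * det3 n (u i) z).
    by rewrite /det3 !vecE; ring.
  by rewrite D0 mulr0.
split=> // x y Px Py /arcP[s [t [s0 t0 e vS]]].
have xS := proj_hull_sphere Px; have yS := proj_hull_sphere Py.
have [s00|s1] := eqVneq s 0.
  right; apply: hull_parallel => //.
  by rewrite -e s00 scale0r add0r crosspZl crosspp scaler0.
have [t00|t1] := eqVneq t 0.
  left; apply: hull_parallel => //.
  by rewrite -e t00 scale0r addr0 crosspZl crosspp scaler0.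
have {s1} sp : 0 < s by rewrite lt0r s1.
have {t1} tp : 0 < t by rewrite lt0r t1.
have nx := proj_hull_ge0 nu Px; have ny := proj_hull_ge0 nu Py.
have n'x := proj_hull_ge0 n'u Px; have n'y := proj_hull_ge0 n'u Py.
have sumn : s * dotp n x + t * dotp n y = 0.
  by rewrite -!dotpZr -dotpDr e.
have sumw : s * dotp w x + t * dotp w y = 0.
  by rewrite -!dotpZr -dotpDr e.
have zero2 (a b : R) : 0 <= a -> 0 <= b -> s * a + t * b = 0 -> a = 0 /\ b = 0.
  move=> a0 b0 /eqP; rewrite paddr_eq0 ?mulr_ge0 // !mulf_eq0.
  by rewrite (gt_eqF sp) (gt_eqF tp) => /andP[/eqP-> /eqP->].
have [nx0 ny0] := zero2 _ _ nx ny sumn.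
rewrite dotpDl dotpZl nx0 mulr0 add0r in n'x.
rewrite dotpDl dotpZl ny0 mulr0 add0r in n'y.
have [wx0 wy0] := zero2 _ _ n'x n'y sumw.
by left; apply: onray.
Qed.

(** The sum c of the vectors in the facet makes a positive product with each of
them, so slopes relative to c order them by angle; the two extreme ones are
vertices. *)
Lemma facet_vertices n i0 j0 : (forall k l, 0 <= dotp (u k) (u l)) ->
  (forall k, 0 <= dotp n (u k)) ->
  crossp (u i0) (u j0) != 0 -> dotp n (u i0) = 0 -> dotp n (u j0) = 0 ->
  n != 0 ->
  exists i j, [/\ hull_vertices U (sproj (u i)), hull_vertices U (sproj (u j)),
    crossp (u i) (u j) != 0, dotp n (u i) = 0 & dotp n (u j) = 0].
Proof.
move=> uu nu ij0 ni0 nj0 n0.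
pose A := [pred k | dotp n (u k) == 0].
pose c : 'cV[R]_3 := \sum_(k | A k) u k.
have c_gt0 k : A k -> 0 < dotp c (u k).
  move=> Ak; rewrite dotpC dotp_sumr (bigD1 k) //=.
  by rewrite ltr_wpDr ?dotp_gt0 // sumr_ge0.
have nc : dotp n c = 0 by rewrite dotp_sumr big1 // => k /eqP.
have Ai0 : A i0 by rewrite /= ni0.
have c0 : 0 < dotp c c.
  by rewrite dotp_gt0; apply: contraTneq (c_gt0 _ Ai0) => ->; rewrite dotp0l ltxx.
have detE (i k : 'I_p) : dotp c (u i) * dotp (crossp n c) (u k)
    - dotp (crossp n c) (u i) * dotp c (u k) = dotp c c * det3 n (u i) (u k).
  transitivity (dotp c c * det3 n (u i) (u k)
    - dotp n c * dotp c (crossp (u i) (u k))).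
    by rewrite /det3 !vecE; ring.
  by rewrite nc mul0r subr0.
have [i Ai iP] := ratio_extremal (fun k => dotp (crossp n c) (u k)) Ai0 c_gt0.
have [j Aj jP] := ratio_extremal (fun k => - dotp (crossp n c) (u k)) Ai0 c_gt0.
have {}iP k : A k -> 0 <= det3 n (u i) (u k).
  by move=> /iP; rewrite detE pmulr_rge0.
have {}jP k : A k -> det3 n (u j) (u k) <= 0.
  move=> /jP; rewrite mulrN mulNr -opprD oppr_ge0 detE.
  by rewrite pmulr_rle0.
have ni := eqP Ai; have nj := eqP Aj.
exists i, j; split=> //.
- by apply: (supported_vertex n0 (oner_neq0 _)) => // k /eqP/iP; rewrite mul1r.
- apply: (@supported_vertex n (- 1)); rewrite ?oppr_eq0 ?oner_eq0 //.
  by move=> k /eqP/jP; rewrite mulN1r oppr_ge0.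
apply: contraNneq ij0 => /crossp_eq0_parallel ij.
have ij_gt0 : 0 < dotp (u i) (u j).
  have := congr1 (dotp h) ij; rewrite !dotpZr => e.
  rewrite -(pmulr_lgt0 _ (h_gt0 j)) -e mulr_gt0 // dotp_gt0 //.
have par k : A k -> crossp (u k) (u j) = 0.
  move=> Ak; apply: (plane_parallel n0 nj (eqP Ak)).
  apply/eqP; rewrite eq_le jP //= -(pmulr_rge0 _ ij_gt0).
  have -> : dotp (u i) (u j) * det3 n (u j) (u k) =
     det3 n (dotp (u i) (u j) *: u j) (u k) by rewrite /det3 !vecE; ring.
  rewrite -ij.
  have -> : det3 n (dotp (u j) (u j) *: u i) (u k) =
     dotp (u j) (u j) * det3 n (u i) (u k) by rewrite /det3 !vecE; ring.
  by rewrite mulr_ge0 ?dotp_ge0 // iP.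
have /crossp_eq0_parallel pi := par i0 Ai0.
have /crossp_eq0_parallel pj : crossp (u j0) (u j) = 0 by apply: par; rewrite /= nj0.
have : crossp (dotp (u j) (u j) *: u i0) (dotp (u j) (u j) *: u j0) = 0.
  by rewrite pi pj crosspZl crosspZr crosspp !scaler0.
rewrite crosspZl crosspZr => /eqP.
by rewrite !scaler_eq0 dotp_eq0 (negbTE (U0 j)).
Qed.

(** Of three distinct rays in a plane, inside an open half space, one lies between
the other two. Which one is read off from the signs of the coefficients of
their linear relation. *)
Lemma vertices_not_coplanar x y z :
  hull_vertices U x -> hull_vertices U y -> hull_vertices U z ->
  x != y -> y != z -> x != z -> det3 x y z != 0.
Proof.
move=> [Px vx] [Py vy] [Pz vz] xy yz xz; apply/eqP => D0.
pose n := crossp x y.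
have rel : det3 n y z *: x + det3 n z x *: y + dotp n n *: z = 0.
  transitivity (det3 x y z *: n); last by rewrite D0 scale0r.
  by rewrite /n /det3; apply: vec3P; rewrite !vecE; ring.
have c0 : 0 < dotp n n.
  by rewrite dotp_gt0; apply: contraNneq xy => /hull_parallel->.
set a := det3 n y z in rel; set b := det3 n z x in rel.
set c := dotp n n in rel c0.
have hx := proj_hull_gt0 h_gt0 Px; have hy := proj_hull_gt0 h_gt0 Py.
have hz := proj_hull_gt0 h_gt0 Pz.
have hrel : a * dotp h x + b * dotp h y + c * dotp h z = 0.
  by rewrite -!dotpZr -!dotpDr rel dotp0r.
have mid (v1 v2 v3 : 'cV[R]_3) (r s t : R) : 0 < r -> 0 <= s -> 0 <= t ->
    P v3 -> r *: v3 = s *: v1 + t *: v2 -> Defs.arc v1 v2 v3.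
  move=> r0 s0 t0 Pv e; apply/arcP; exists (r^-1 * s), (r^-1 * t).
  have ri : 0 <= r^-1 by rewrite invr_ge0 ltW.
  split; rewrite ?mulr_ge0 //; last exact: proj_hull_sphere.
  by rewrite -!scalerA -scalerDr -e scalerA mulVf ?scale1r // gt_eqF.
have neg (v w : 'cV[R]_3) : v + w = 0 -> v = - w.
  by move/eqP; rewrite addr_eq0 => /eqP.
have [a0|a0] := ltP 0 a.
  have b0 : 0 < - b.
    rewrite oppr_gt0 ltNge; apply/negP => b0.
    have := mulr_gt0 c0 hz; have := mulr_gt0 a0 hx.
    by have := mulr_ge0 b0 (ltW hy); lra.
  case: (vy x z Px Pz) => [|/eqP|/eqP]; last 2 first.
  - by rewrite eq_sym (negbTE xy).
  - by rewrite (negbTE yz).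
  apply: (mid _ _ _ (- b) a c) => //; try exact: ltW.
  by rewrite scaleNr; apply/esym/neg; rewrite addrAC.
have [b0|b0] := ltP 0 b.
  have a1 : 0 < - a.
    rewrite oppr_gt0 ltNge; apply/negP => a1.
    have := mulr_gt0 c0 hz; have := mulr_gt0 b0 hy.
    by have := mulr_ge0 a1 (ltW hx); lra.
  case: (vx y z Py Pz) => [|/eqP|/eqP]; last 2 first.
  - by rewrite (negbTE xy).
  - by rewrite (negbTE xz).
  apply: (mid _ _ _ (- a) b c) => //; try exact: ltW.
  by rewrite scaleNr; apply/esym/neg; rewrite addrC addrA.
case: (vz x y Px Py) => [|/eqP|/eqP]; last 2 first.
- by rewrite eq_sym (negbTE xz).
- by rewrite eq_sym (negbTE yz).
apply: (mid _ _ _ c (- a) (- b)) => //; rewrite ?oppr_ge0 //.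
by rewrite !scaleNr -opprD; apply: neg; rewrite addrC.
Qed.

Definition one_sided v w :=
  (forall k, 0 <= det3 v w (u k)) \/ (forall k, det3 v w (u k) <= 0).

Lemma one_sidedP v w : one_sided v w ->
  (forall z, P z -> 0 <= det3 v w z) \/ (forall z, P z -> det3 v w z <= 0).
Proof.
case=> vw; [left|right] => z Pz.
  rewrite det3_crossp; apply: proj_hull_ge0 Pz => // k.
  by rewrite -det3_crossp.
rewrite -oppr_ge0 det3_crossp -dotpNl; apply: proj_hull_ge0 Pz => // k.
by rewrite dotpNl -det3_crossp oppr_ge0.
Qed.

Lemma one_sidedC v w : one_sided v w -> one_sided w v.
Proof.
have swap z : det3 w v z = - det3 v w z by rewrite /det3 !vecE; ring.
by case=> vw; [right|left] => k; rewrite swap ?oppr_ge0 ?oppr_le0.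
Qed.

(** By the pigeonhole principle the determinants of two of the three pairs have the
same sign on all vectors, say those of w1 and w2. Then det3 v w1 w2 and
det3 v w2 w1, which are opposite, have the same sign, so that v, w1 and w2 are
coplanar. *)
Lemma at_most_two_neighbours v w1 w2 w3 :
  hull_vertices U v -> hull_vertices U w1 -> hull_vertices U w2 ->
  hull_vertices U w3 ->
  v != w1 -> v != w2 -> v != w3 -> w1 != w2 -> w1 != w3 -> w2 != w3 ->
  one_sided v w1 -> one_sided v w2 -> one_sided v w3 -> False.
Proof.
move=> Vv V1 V2 V3 n1 n2 n3 n12 n13 n23.
have same w w' : hull_vertices U w -> hull_vertices U w' ->
    v != w -> v != w' -> w != w' ->
    0 <= det3 v w w' -> 0 <= det3 v w' w -> False.
  move=> Vw Vw' vw vw' ww' d; rewrite det3C oppr_ge0 => d'.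
  have /negP := vertices_not_coplanar Vv Vw Vw' vw ww' vw'; apply.
  by rewrite eq_le d d'.
have same' w w' : hull_vertices U w -> hull_vertices U w' ->
    v != w -> v != w' -> w != w' ->
    det3 v w w' <= 0 -> det3 v w' w <= 0 -> False.
  move=> Vw Vw' vw vw' ww' d d'.
  apply: (same w w') => //; rewrite det3C oppr_ge0 //.
have [P1 P2 P3] := And3 V1.1 V2.1 V3.1.
move=> /one_sidedP[] s1 /one_sidedP[] s2 /one_sidedP[] s3;
  by [ exact: (same w1 w2 V1 V2) (s1 _ P2) (s2 _ P1)
     | exact: (same' w1 w2 V1 V2) (s1 _ P2) (s2 _ P1)
     | exact: (same w1 w3 V1 V3) (s1 _ P3) (s3 _ P1)
     | exact: (same' w1 w3 V1 V3) (s1 _ P3) (s3 _ P1)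
     | exact: (same w2 w3 V2 V3) (s2 _ P3) (s3 _ P2)
     | exact: (same' w2 w3 V2 V3) (s2 _ P3) (s3 _ P2)].
Qed.

End Pointed.

Lemma dotp_continuous c : continuous (dotp c).
Proof.
move=> x.
have -> : dotp c = fun x => c i0 0 * x i0 0 + c i1 0 * x i1 0 + c i2 0 * x i2 0.
  by apply/funext => z; rewrite dotpE.
have coord i : (fun z : 'cV[R]_3 => z i 0) @ x --> x i 0.
  exact: (@coord_continuous R 3 1 i 0 x).
have coord' i : (fun z : 'cV[R]_3 => c i 0 * z i 0) @ x --> c i 0 * x i 0.
  exact: cvgM (cvg_cst _) (coord i).
exact: cvgD (cvgD (coord' i0) (coord' i1)) (coord' i2).
Qed.

Lemma near_dotp_gt0 c x : 0 < dotp c x -> \forall z \near x, 0 < dotp c z.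
Proof. by move=> cx; apply: (cvgr_gt _ (@dotp_continuous c x)). Qed.

Lemma proj_hull_cone x y z (r s t : R) : P x -> P y -> P z ->
  0 <= r -> 0 <= s -> 0 <= t -> sphere (r *: x + s *: y + t *: z) ->
  P (r *: x + s *: y + t *: z).
Proof.
move=> Px Py Pz r0 s0 t0 S.
have [xy0|xy0] := eqVneq (r *: x + s *: y) 0.
  apply: (proj_hull_arc Px Pz); apply/arcP; exists 0, t; split=> //.
  by rewrite xy0 scale0r.
have Pxy : P (sproj (r *: x + s *: y)).
  apply: (proj_hull_arc Px Py); apply/arcP.
  exists ((enorm (r *: x + s *: y))^-1 * r), ((enorm (r *: x + s *: y))^-1 * s).
  rewrite !mulr_ge0 ?invr_ge0 ?sqrtr_ge0 //; split=> //.
    by rewrite -!scalerA -scalerDr.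
  exact: sproj_sphere.
apply: (proj_hull_arc Pxy Pz); apply/arcP.
exists (enorm (r *: x + s *: y)), t; split=> //; first exact: sqrtr_ge0.
by rewrite /sproj scalerA mulfV ?scale1r // gt_eqF // enorm_gt0.
Qed.

(** If there were vectors strictly on both sides, the two simplicial cones that
they span with v and w would cover a neighbourhood of v + w, so the midpoint
of the arc would be interior to the hull. *)
Lemma boundary_arc_one_sided v w : P v -> P w ->
  Defs.arc v w `<=` sph_boundary P -> one_sided v w.
Proof.
move=> Pv Pw bd; apply: contrapT => /not_orP[].
move=> /existsNP[k1 /negP]; rewrite -ltNge => D1.
move=> /existsNP[k2 /negP]; rewrite -ltNge => D2.
have vw0 : v + w != 0.
  apply: contraTneq D2 => e; rewrite -leNgt.
  have -> : det3 v w (u k2) = det3 (v + w) w (u k2).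
    by rewrite /det3 !vecE; ring.
  by rewrite e /det3 dotp0l.
have [] := bd (sproj (v + w)).
  by exists 1, 1; split; rewrite ?ler01 ?scale1r.
move=> _; rewrite /closure /= => /(_ (fun z =>
  [/\ 0 < det3 z w (u k2), 0 < det3 v z (u k2), det3 z w (u k1) < 0
     & det3 v z (u k1) < 0])).
case=> [|z [[zS zP] [z1 z2 z3 z4]]].
  have c1 z : det3 z w (u k2) = dotp (crossp w (u k2)) z by rewrite dotpC.
  have c2 z : det3 v z (u k2) = dotp (crossp (u k2) v) z.
    by rewrite /det3 !vecE; ring.
  have c3 z : det3 z w (u k1) = - dotp (crossp (u k1) w) z.
    by rewrite /det3 !vecE; ring.
  have c4 z : det3 v z (u k1) = - dotp (crossp v (u k1)) z.
    by rewrite /det3 !vecE; ring.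
  have near c : 0 < dotp c (v + w) ->
      \forall z \near sproj (v + w), 0 < dotp c z.
    by move=> cv; apply: near_dotp_gt0; rewrite dotp_sproj_gt0.
  near=> z; split; rewrite ?c1 ?c2 ?c3 ?c4 ?oppr_lt0; near: z; apply: near.
  - by rewrite -c1; move: D2; rewrite /det3 !vecE; lra.
  - by rewrite -c2; move: D2; rewrite /det3 !vecE; lra.
  - by rewrite -oppr_lt0 -c3; move: D1; rewrite /det3 !vecE; lra.
  - by rewrite -oppr_lt0 -c4; move: D1; rewrite /det3 !vecE; lra.
apply: zP; have cramer k : det3 v w (u k) *: z =
    det3 z w (u k) *: v + det3 v z (u k) *: w + det3 v w z *: u k.
  by rewrite /det3; apply: vec3P; rewrite !vecE; ring.
have fromk k (e : R) : 0 < e * det3 v w (u k) -> 0 <= e * det3 z w (u k) ->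
    0 <= e * det3 v z (u k) -> 0 <= e * det3 v w z -> P z.
  move=> D0 A B C; have D0' : e * det3 v w (u k) != 0 by rewrite gt_eqF.
  have e0 : e != 0 by apply: contraNneq D0' => ->; rewrite mul0r.
  have en0 : 0 < enorm (u k) by rewrite enorm_gt0.
  have zE : z = (e * det3 z w (u k) / (e * det3 v w (u k))) *: v +
      (e * det3 v z (u k) / (e * det3 v w (u k))) *: w +
      (e * det3 v w z / (e * det3 v w (u k)) * enorm (u k)) *: sproj (u k).
    apply: (scalerI D0'); rewrite -[LHS]scalerA cramer /sproj !scalerDr !scalerA.
    congr (_ *: _ + _ *: _ + _ *: _); try by rewrite mulrCA mulfV ?mulr1.
    by rewrite mulrA mulfK ?gt_eqF // mulrCA mulfV ?mulr1.
  rewrite zE; apply: proj_hull_cone; rewrite -?zE //.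
  - exact: proj_hull_gen.
  - by rewrite divr_ge0 // ltW.
  - by rewrite divr_ge0 // ltW.
  - by rewrite mulr_ge0 ?divr_ge0 // ltW.
(* A point on the side of u k2 belongs to the cone of v, w and u k2, the others to
the cone of v, w and u k1. *)
have [d|d] := leP 0 (det3 v w z).
  by apply: (fromk k2 1); rewrite !mul1r // ltW.
by apply: (fromk k1 (- 1)); rewrite !mulN1r ?oppr_gt0 ?oppr_ge0 // ltW.
Unshelve. all: by end_near.
Qed.

End Hull.

(** * Facets of the hull are traversed *)

Section Cycle.
Variable T : eqType.

Lemma zip_rot (s t : seq T) i : size s = size t ->
  zip (rot i s) (rot i t) = rot i (zip s t).
Proof.
move=> e; rewrite /rot zip_cat ?size_drop ?e //; congr (_ ++ _).
  elim: i s t e => [|i IH] [|x s] [|y t] //= [e]; exact: IH.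
elim: i s t e => [|i IH] [|x s] [|y t] //= [e]; congr (_ :: _); exact: IH.
Qed.

(** The hypothesis excludes that the successor z and the predecessor t of x differ
from each other and from y. If z = t, the cycle consists of x and z only. *)
Lemma cycle_adjacent (e : rel T) (s : seq T) x y :
  uniq s -> cycle e s -> x \in s -> y \in s -> x != y ->
  (forall z t, z \in s -> t \in s -> e x z -> e t x ->
     x != z -> x != t -> y != z -> y != t -> z != t -> False) ->
  (x, y) \in zip s (rot 1 s) \/ (y, x) \in zip s (rot 1 s).
Proof.
move=> us cs xs; case: (rot_to xs) => i s' def_s.
have memE z : (z \in s) = (z \in x :: s') by rewrite -def_s mem_rot.
have memzip q : (q \in zip s (rot 1 s)) = (q \in zip (x :: s') (rcons s' x)).
  by rewrite -(mem_rot i) -zip_rot ?size_rot // rot_rot def_s rot1_cons.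
rewrite memE !memzip inE eq_sym => /predU1P[->|ys']; first by rewrite eqxx.
move=> yx none.
move: us cs; rewrite -(rot_uniq i) -(rot_cycle i) def_s /= => /andP[xs' us'].
case: s' => [|z s'] in def_s memE memzip ys' xs' us' *; first by [].
case/lastP: s' => [|s' t] in def_s memE memzip ys' xs' us' *.
  move=> _; left; move: ys'; rewrite inE => /eqP->.
  by rewrite /= inE eqxx.
rewrite -rcons_cons !rcons_path last_rcons => /andP[/= /andP[/andP[exz _] _] etx].
have [->|yz] := eqVneq y z; first by left; rewrite inE eqxx.
have [->|yt] := eqVneq y t.
  right; rewrite -!rcons_cons zip_rcons /=; last by rewrite !size_rcons.
  by rewrite !(inE, mem_rcons) eqxx !orbT.
case: (none z t) => //; rewrite ?memE ?inE ?mem_rcons ?inE ?eqxx ?orbT //.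
- by apply: contraNneq xs' => ->; rewrite inE eqxx.
- by apply: contraNneq xs' => ->; rewrite inE mem_rcons inE eqxx orbT.
- case/andP: us' => zs' _; apply: contraNneq zs' => ->.
  by rewrite mem_rcons inE eqxx.
Qed.

End Cycle.

Section Traversal.
Variables (R : realType) (p : nat) (U : 'M[R]_(3, p)) (ks : seq 'I_p).
Hypothesis U0 : nonzero_cols U.
Hypothesis uu : forall k l, 0 <= dotp (col k U) (col l U).
Hypothesis trav : boundary_traversal U ks.

Lemma sum_cols_gt0 k : 0 < dotp (\sum_l col l U) (col k U).
Proof.
by rewrite dotpC dotp_sumr (bigD1 k) //= ltr_wpDr ?dotp_gt0 // sumr_ge0.
Qed.

Let v k := sproj (col k U).

Lemma traversal_uniq : uniq ks /\ {in ks &, injective v}.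
Proof.
have [uv _ _] := trav; split; first exact: map_uniq uv.
move=> k l kks lks e; apply/eqP; rewrite -(nth_index k kks) -(nth_index k lks).
rewrite nth_uniq ?index_mem // ?(map_uniq uv) //.
rewrite -(nth_uniq (v k) _ _ uv) ?size_map ?index_mem //.
by rewrite !(nth_map k) ?index_mem // !nth_index // -/(v k) e.
Qed.

Lemma traversal_vertexP x : hull_vertices U x <-> exists2 k, k \in ks & x = v k.
Proof.
have [_ <- _] := trav; split=> [/mapP//|h]; exact/mapP.
Qed.

(** The two extreme vertices v i' and v j' of the facet see all vectors on one side
of their plane, and so do v i' and its neighbours in the traversal, since the
arcs to them lie in the boundary. As v i' has at most two such neighbours, v j'
is next to it. *)
Lemma facet_edge_traversed n i0 j0 : (forall k, 0 <= dotp n (col k U)) ->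
  crossp (col i0 U) (col j0 U) != 0 ->
  dotp n (col i0 U) = 0 -> dotp n (col j0 U) = 0 -> n != 0 ->
  exists k l, [/\ (k, l) \in zip ks (rot 1 ks),
    crossp (col k U) (col l U) != 0, dotp n (col k U) = 0
    & dotp n (col l U) = 0].
Proof.
move=> nu ij ni nj n0.
have [i [j [Vi Vj {}ij {}ni {}nj]]] :=
  facet_vertices U0 sum_cols_gt0 uu nu ij ni nj n0.
have [i' i'ks ei] := (traversal_vertexP _).1 Vi.
have [j' j'ks ej] := (traversal_vertexP _).1 Vj.
have [uks vinj] := traversal_uniq.
have enorm_neq0 k : enorm (col k U) != 0 by rewrite gt_eqF // enorm_gt0.
have ni' : dotp n (col i' U) = 0.
  by apply/eqP; rewrite -dotp_sproj_eq0 // -/(v i') -ei dotp_sproj_eq0 // ni.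
have nj' : dotp n (col j' U) = 0.
  by apply/eqP; rewrite -dotp_sproj_eq0 // -/(v j') -ej dotp_sproj_eq0 // nj.
have cross_sproj k l : (crossp (sproj (col k U)) (sproj (col l U)) == 0) =
    (crossp (col k U) (col l U) == 0).
  by rewrite /sproj crosspZl crosspZr !scaler_eq0 !invr_eq0 !(negbTE (enorm_neq0 _)).
have ij' : crossp (col i' U) (col j' U) != 0.
  by rewrite -cross_sproj -/(v i') -/(v j') -ei -ej cross_sproj.
have one_sided_n w w' : dotp n w = 0 -> dotp n w' = 0 -> one_sided U w w'.
  move=> nw nw'; have e := plane_crossp nw nw'.
  have nn : 0 < dotp n n by rewrite dotp_gt0.
  have sg k : dotp n n * det3 w w' (col k U) = det3 n w w' * dotp n (col k U).
    by rewrite det3_crossp -dotpZl e dotpZl.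
  have [d|d] := leP 0 (det3 n w w'); [left|right] => k.
    by rewrite -(pmulr_rge0 _ nn) sg mulr_ge0.
  by rewrite -(pmulr_rle0 _ nn) sg mulr_le0_ge0 // ltW.
pose e (k l : 'I_p) := `[< Defs.arc (v k) (v l) `<=` sph_boundary (proj_hull U) >].
have cyc : cycle e ks.
  by have [_ _] := trav; rewrite cycle_map.
have i'j' : i' != j' by apply: contraNneq ij' => ->; rewrite crosspp.
have vert k : k \in ks -> hull_vertices U (v k).
  by move=> kks; apply/traversal_vertexP; exists k.
have vneq k l : k \in ks -> l \in ks -> k != l -> v k != v l.
  by move=> kks lks; apply: contraNneq => /(vinj _ _ kks lks) ->.
have [|zipij|zipji] := cycle_adjacent uks cyc i'ks j'ks i'j'.
- move=> z t zks tks /asboolP ez /asboolP et iz it jz jt zt.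
  apply: (at_most_two_neighbours U0 sum_cols_gt0
    (v := v i') (w1 := v j') (w2 := v z) (w3 := v t));
    try by [apply: vert|apply: vneq].
  + rewrite -ei -ej; apply: one_sided_n; apply/eqP;
      by rewrite dotp_sproj_eq0 // (ni, nj).
  + by apply: boundary_arc_one_sided ez => //; [case: (vert i')|case: (vert z)].
  + apply: one_sidedC; apply: boundary_arc_one_sided et => //.
      by case: (vert t).
    by case: (vert i').
- by exists i', j'.
- by exists j', i'; split=> //; rewrite crosspC oppr_eq0.
Qed.

End Traversal.

(** * The instructions, and the sweep in the plane orthogonal to a normal *)

Section Programs.
Variable R : realType.
Implicit Types (a b g u v w x y : 'cV[R]_3) (us : seq 'cV[R]_3).

Lemma result_bind A B (c : prog R A) (f : A -> prog R B) :
  result (bind c f) = result (f (result c)).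
Proof. by elim: c => //=. Qed.

Lemma cost_bind A B (c : prog R A) (f : A -> prog R B) :
  cost (bind c f) = (cost c + cost (f (result c)))%N.
Proof. by elim: c => //= [n k|o x y k|x k|x y k] ->. Qed.

Lemma result_dot x y : result (dot_ x y) = dotp x y.
Proof. by rewrite dotpE. Qed.

Lemma result_scale (s : R) x : result (scale_ s x) = s *: x.
Proof. by apply: vec3P; rewrite /= !vecE. Qed.

Lemma result_sub x y : result (sub_ x y) = x - y.
Proof. by apply: vec3P; rewrite /= !vecE. Qed.

Lemma result_opp x : result (opp_ x) = - x.
Proof. by apply: vec3P; rewrite /= !vecE; ring. Qed.

Lemma result_cross x y : result (cross_ x y) = crossp x y.
Proof. by apply: vec3P; rewrite /= !vecE. Qed.

Lemma result_is_zero x : result (is_zero_ x) = (x == 0).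
Proof.
rewrite /is_zero_ result_bind result_dot /= -dotp_eq0 eq_le dotp_ge0 andbT //.
Qed.

Lemma result_normalize x : result (normalize_ x) = sproj x.
Proof.
rewrite /normalize_ result_bind result_dot /=.
by apply: vec3P; rewrite [RHS]mxE !mkvecE mul1r.
Qed.

Definition proj g u := u - dotp g u *: g.

Lemma result_project g u : result (project_ g u) = proj g u.
Proof.
by rewrite /project_ result_bind result_dot result_bind result_scale result_sub.
Qed.

Definition resultE := (result_dot, result_scale, result_sub, result_opp,
  result_cross, result_is_zero, result_normalize, result_project, result_bind).

Lemma result_some_orthogonal x : x != 0 ->
  result (some_orthogonal_ x) != 0 /\ dotp (result (some_orthogonal_ x)) x = 0.
Proof.
move=> x0; rewrite /some_orthogonal_ !resultE /=.
have orth z : dotp (crossp x z) x = 0 by rewrite !vecE; ring.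
case: ifP => [/eqP e|/negbT h] /=; last by rewrite orth.
rewrite -/(crossp x (mkvec 0 1 0)) orth; split=> //; apply: contraNneq x0 => e'.
have := congr1 (fun v : 'cV[R]_3 => v i1 0) e.
have := congr1 (fun v : 'cV[R]_3 => v i2 0) e.
have := congr1 (fun v : 'cV[R]_3 => v i2 0) e'.
rewrite !vecE => h0 h1 h2; apply/eqP/vec3P; rewrite mxE; lra.
Qed.

Lemma result_unit_normal a b : a != 0 ->
  let g := result (unit_normal_ a b) in
  [/\ sphere g, dotp g a = 0 & crossp a b != 0 -> g = sproj (crossp a b)].
Proof.
move=> a0; rewrite /unit_normal_ !resultE /=.
have [ab|ab] := eqVneq (crossp a b) 0.
  have [n0 na] := result_some_orthogonal a0; split=> //.
    exact: sproj_sphere.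
  by apply/eqP; rewrite dotpC dotp_sproj_eq0 // dotpC na.
rewrite /=; split=> //; first exact: sproj_sphere.
by apply/eqP; rewrite dotpC dotp_sproj_eq0 // !vecE; apply/eqP; ring.
Qed.

Lemma result_halfspace g us : result (halfspace_ g us) =
  (all (fun u => 0 <= dotp g u) us, all (fun u => dotp g u <= 0) us).
Proof. by elim: us => //= u us IH; rewrite result_bind IH -dotpE. Qed.

Definition cone v1 v2 w :=
  exists s t : R, [/\ 0 <= s, 0 <= t & w = s *: v1 + t *: v2].

Lemma cone_trans v1 v2 w1 w2 w :
  cone w1 w2 v1 -> cone w1 w2 v2 -> cone v1 v2 w -> cone w1 w2 w.
Proof.
move=> [a [b [a0 b0 ->]]] [c [d [c0 d0 ->]]] [s [t [s0 t0 ->]]].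
exists (s * a + t * c), (s * b + t * d); split; rewrite ?addr_ge0 ?mulr_ge0 //.
by apply: vec3P; rewrite !vecE; ring.
Qed.

Lemma cone_l v1 v2 : cone v1 v2 v1.
Proof. by exists 1, 0; rewrite ler01 lexx scale1r scale0r addr0. Qed.

Lemma cone_r v1 v2 : cone v1 v2 v2.
Proof. by exists 0, 1; rewrite ler01 lexx scale1r scale0r add0r. Qed.

Section Plane.
Variable g : 'cV[R]_3.
Hypothesis g_unit : dotp g g = 1.
Local Notation plane v := (dotp g v = 0).

(** Decomposition of w in the orthogonal basis v, g * v of the plane. *)
Lemma plane_frame v w : plane v -> plane w ->
  dotp v v *: w = dotp v w *: v + det3 g v w *: crossp g v.
Proof.
move=> gv gw.
transitivity (dotp (crossp g v) (crossp g v) *: w).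
  by rewrite dotp_crossp gv g_unit expr0n /= subr0 mul1r.
transitivity ((dotp v v * dotp g w - dotp g v * dotp v w) *: g
   + (dotp g g * dotp v w - dotp g v * dotp g w) *: v
   + det3 g v w *: crossp g v).
  by rewrite /det3; apply: vec3P; rewrite !vecE; ring.
by rewrite gv gw g_unit !mul0r mulr0 !subr0 scale0r add0r mul1r.
Qed.

Lemma plane_det v w z : plane v -> plane w -> plane z ->
  dotp v v * det3 g w z = dotp v w * det3 g v z - det3 g v w * dotp v z.
Proof.
move=> gv gw gz.
have -> : dotp v v * det3 g w z = det3 g (dotp v v *: w) z.
  by rewrite /det3 !vecE; ring.
rewrite plane_frame //.
transitivity (dotp v w * det3 g v z + det3 g v w *
   (dotp g v * dotp g z - dotp g g * dotp v z)).
  by rewrite /det3 !vecE; ring.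
by rewrite gv g_unit; ring.
Qed.

(** The state that the sweep maintains. *)
Definition nonobtuse_pair v1 v2 :=
  [/\ plane v1 /\ plane v2, v1 != 0, v2 != 0, 0 <= dotp v1 v2 & 0 <= det3 g v1 v2].

Lemma between_cone v1 v2 w : nonobtuse_pair v1 v2 -> plane w ->
  0 <= det3 g v1 w -> 0 <= det3 g w v2 -> 0 <= dotp v1 w -> cone v1 v2 w.
Proof.
move=> [[p1 p2] n1 n2 d12 D12] pw D1 D2 d1.
have n11 : 0 < dotp v1 v1 by rewrite dotp_gt0.
have e := plane_det p1 pw p2.
have ew := plane_frame p1 pw; have ev := plane_frame p1 p2.
move: D12; rewrite le_eqVlt => /predU1P[D0|Dp].
  have D1w : det3 g v1 w = 0.
    have dn : 0 < dotp v1 v2.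
      rewrite lt0r d12 andbT; apply: contraNneq n2 => d0.
      move: ev; rewrite d0 -D0 !scale0r addr0 => /eqP.
      by rewrite scaler_eq0 (gt_eqF n11).
    apply/eqP; rewrite eq_le D1 andbT -(pmulr_lle0 _ dn).
    rewrite -oppr_ge0; have := mulr_ge0 (ltW n11) D2; rewrite e -D0 mulr0 sub0r //.
  exists (dotp v1 w / dotp v1 v1), 0; split=> //.
    by rewrite divr_ge0 // ltW.
  rewrite scale0r addr0; apply: (scalerI (lt0r_neq0 n11)).
  by rewrite ew D1w scale0r addr0 scalerA mulrCA mulfV ?mulr1 // gt_eqF.
exists (det3 g w v2 / det3 g v1 v2), (det3 g v1 w / det3 g v1 v2).
split; rewrite ?divr_ge0 // ?ltW //.
apply: (scalerI (lt0r_neq0 (mulr_gt0 n11 Dp))).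
rewrite scalerDr !scalerA.
have -> : dotp v1 v1 * det3 g v1 v2 * (det3 g w v2 / det3 g v1 v2) =
   dotp v1 v1 * det3 g w v2 by field; rewrite gt_eqF.
have -> : dotp v1 v1 * det3 g v1 v2 * (det3 g v1 w / det3 g v1 v2) =
   det3 g v1 w * dotp v1 v1 by field; rewrite gt_eqF.
rewrite e -[_ *: v2]scalerA ev mulrC -scalerA ew.
by apply: vec3P; rewrite !vecE; ring.
Qed.

(** The sweep never replaces both vectors of its pair at once, since a vector
within a right angle of both cannot be clockwise of the first and
counterclockwise of the second. *)
Lemma sweep_exclusive v1 v2 w : nonobtuse_pair v1 v2 -> plane w ->
  0 <= dotp v1 w -> 0 <= dotp v2 w -> det3 g v1 w < 0 -> det3 g v2 w <= 0.
Proof.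
move=> [[p1 p2] n1 n2 d12 D12] pw d1 d2 D1; rewrite leNgt; apply/negP => D2.
have n11 : 0 < dotp v1 v1 by rewrite dotp_gt0.
have e2 := plane_det p1 p2 pw.
have := mulr_gt0 n11 D2; rewrite e2.
have := mulr_ge0 D12 d1; have := mulr_ge0_le0 d12 (ltW D1).
by lra.
Qed.

Lemma plane_project u : plane (proj g u).
Proof. by rewrite /proj dotpDr dotpNr dotpZr g_unit mulr1 subrr. Qed.

Lemma result_sweep_cons v1 v2 u us : result (sweep_ g v1 v2 (u :: us)) =
  let w := proj g u in
  if (0 <= dotp v1 w) && (0 <= dotp v2 w) then
    result (sweep_ g (if 0 <= det3 g v1 w then v1 else w)
                     (if det3 g v2 w <= 0 then v2 else w) us)
  else None.
Proof.
rewrite /sweep_ -/(@sweep_ _) !resultE /=.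
case: ifP => //= _.
by rewrite -/(crossp g v1) -/(crossp g v2) -!dotpE -!det3_crossp.
Qed.

(** Replacing one vector of the pair by w only enlarges the cone spanned by the
pair: the replaced vector lies between w and the one that is kept. *)
Lemma sweep_sound us v1 v2 w1 w2 : nonobtuse_pair v1 v2 ->
  result (sweep_ g v1 v2 us) = Some (w1, w2) ->
  [/\ nonobtuse_pair w1 w2, cone w1 w2 v1, cone w1 w2 v2 &
      forall u, u \in us -> cone w1 w2 (proj g u)].
Proof.
elim: us v1 v2 => [|u us IH] v1 v2 ra.
  by case=> <- <-; split=> //; [exact: cone_l|exact: cone_r].
rewrite result_sweep_cons; set w := proj g u; cbv zeta.
have pw : plane w by exact: plane_project.
case: ifP => // /andP[d1 d2] res.
have [[p1 p2] n1 n2 d12 D12] := ra.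
suff [v1' [v2' [ra' c1 c2 cw res']]] : exists v1' v2',
    [/\ nonobtuse_pair v1' v2', cone v1' v2' v1, cone v1' v2' v2, cone v1' v2' w
      & result (sweep_ g v1' v2' us) = Some (w1, w2)].
  have [ra'' c1' c2' cs] := IH _ _ ra' res'.
  split=> //; [exact: cone_trans c1|exact: cone_trans c2|].
  move=> x; rewrite inE => /predU1P[->|]; last exact: cs.
  exact: cone_trans cw.
move: res; case: (leP 0 (det3 g v1 w)) => D1.
  case: (leP (det3 g v2 w) 0) => D2 res.
    exists v1, v2; split=> //; [exact: cone_l|exact: cone_r|].
    by apply: between_cone; rewrite // det3C oppr_ge0.
  exists v1, w.
  have w0 : w != 0 by apply: contraTneq D2 => ->; rewrite /det3 crossp0r dotp0r ltxx.
  have ra' : nonobtuse_pair v1 w by [].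
  split=> //; [exact: cone_l| |exact: cone_r].
  by apply: between_cone => //; rewrite ltW.
have D2 := sweep_exclusive ra pw d1 d2 D1; rewrite D2 => res.
exists w, v2.
have w0 : w != 0 by apply: contraTneq D1 => ->; rewrite /det3 crossp0r dotp0r ltxx.
have ra' : nonobtuse_pair w v2 by split=> //; rewrite 1?dotpC // det3C oppr_ge0.
split=> //; [|exact: cone_r|exact: cone_l].
apply: between_cone => //; last by rewrite dotpC.
by rewrite det3C oppr_ge0 ltW.
Qed.

(** The pair always consists of projections that have been processed. *)
Lemma sweep_complete us v1 v2 :
  (forall u, u \in us -> 0 <= dotp v1 (proj g u)) ->
  (forall u, u \in us -> 0 <= dotp v2 (proj g u)) ->
  {in us &, forall u u', 0 <= dotp (proj g u) (proj g u')} ->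
  result (sweep_ g v1 v2 us) <> None.
Proof.
elim: us v1 v2 => // u us IH v1 v2 h1 h2 h.
have uu : u \in u :: us by rewrite inE eqxx.
have sub x : x \in us -> x \in u :: us by rewrite inE orbC => ->.
rewrite result_sweep_cons; cbv zeta; rewrite h1 // h2 //=; apply: IH.
- by move=> x xs; case: ifP => _; [apply/h1/sub|apply: h => //; exact: sub].
- by move=> x xs; case: ifP => _; [apply/h2/sub|apply: h => //; exact: sub].
- by move=> x y xs ys; apply: h; exact: sub.
Qed.

End Plane.
End Programs.

(** * Correctness and cost of trying a list of edges *)

Section Correctness.
Variable R : realType.
Implicit Types (a b g u v n : 'cV[R]_3) (us : seq 'cV[R]_3).

Lemma dotp_proj g u v : dotp g g = 1 ->
  dotp (proj g u) (proj g v) = dotp u v - dotp g u * dotp g v.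
Proof.
move=> g1; transitivity
  (dotp u v - dotp g u * dotp g v *+ 2 + dotp g g * dotp g u * dotp g v).
  by rewrite /proj !vecE; ring.
by rewrite g1; ring.
Qed.

Lemma col_mkbasis (f1 f2 f3 : 'cV[R]_3) :
  (col i0 (mkbasis f1 f2 f3) = f1) * (col i1 (mkbasis f1 f2 f3) = f2) *
  (col i2 (mkbasis f1 f2 f3) = f3).
Proof.
by do ![split]; apply/colP => i; rewrite !mxE (tnth_nth f1) /= inordK.
Qed.

Lemma orthonormal_mkbasis (f1 f2 f3 : 'cV[R]_3) :
  dotp f1 f1 = 1 -> dotp f2 f2 = 1 -> dotp f3 f3 = 1 ->
  dotp f1 f2 = 0 -> dotp f1 f3 = 0 -> dotp f2 f3 = 0 ->
  orthonormal_basis (mkbasis f1 f2 f3).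
Proof.
move=> e11 e22 e33 e12 e13 e23; apply/matrixP => i j.
transitivity (dotp (col i (mkbasis f1 f2 f3)) (col j (mkbasis f1 f2 f3))).
  by rewrite /dotp !mxE; apply: eq_bigr => k _; rewrite !mxE.
rewrite !mxE; have ne : (i0 == i1 = false) * (i0 == i2 = false) * (i1 == i2 = false).
  by do ![split]; apply/negbTE; rewrite -val_eqE /= !inordK.
by case: (ord3P i) (ord3P j) => -> [] ->;
  rewrite !col_mkbasis ?eqxx // ?[dotp f2 f1]dotpC ?[dotp f3 _]dotpC
    ?e12 ?e13 ?e23 ?e33 // ?ne // eq_sym ne.
Qed.

Lemma result_try_edge us a b : result (try_edge_ us a b) =
  let g := result (unit_normal_ a b) in
  let same_side := all (fun u => 0 <= dotp g u) us in
  if same_side || all (fun u => dotp g u <= 0) us then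
    if result (sweep_ g a a us) is Some (v1, _) then
      Some (mkbasis (if same_side then g else - g) (sproj v1)
              (crossp g (sproj v1)))
    else None
  else None.
Proof.
rewrite /try_edge_ result_bind; set g := result (unit_normal_ a b); cbv zeta.
rewrite result_bind result_halfspace /=; case: ifP => // _.
rewrite result_bind; case: (result (sweep_ _ _ _ _)) => [[v1 v2]|] //.
rewrite result_bind /basis_from_; congr Some.
rewrite result_bind result_bind result_normalize result_bind result_cross /=.
by case: (all _ _); rewrite ?result_opp.
Qed.

(** The degenerate starting pair (a, a) is a nonobtuse_pair because a is nonzero
and orthogonal to g. The coordinates of u other than the one along g are, up to
a positive factor, dotp v1 u and det3 g v1 u; they depend only on the
projection of u, which lies in the cone of the final pair. *)
Lemma try_edge_sound us a b F : a != 0 ->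
  result (try_edge_ us a b) = Some F ->
  orthonormal_basis F /\ forall u, u \in us -> forall i, 0 <= dotp (col i F) u.
Proof.
move=> a0; have [/sphereP g1 ga _] := result_unit_normal b a0.
rewrite result_try_edge; cbv zeta; set g := result (unit_normal_ a b) in g1 ga *.
case: ifP => // side; case E: (result _) => [[v1 v2]|] // [<-].
have ra : nonobtuse_pair g a a.
  by split=> //; rewrite ?dotp_ge0 // /det3 crosspp dotp0r.
have [[[p1 p2] n1 n2 d12 D12] _ _ cone_us] := sweep_sound g1 ra E.
have f2f2 : dotp (sproj v1) (sproj v1) = 1 by apply/sphereP/sproj_sphere.
have gf2 : dotp g (sproj v1) = 0 by rewrite /sproj dotpZr p1 mulr0.
set f1 := if _ then g else _.
have f1E : f1 = g \/ f1 = - g by rewrite /f1; case: ifP; [left|right].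
split.
  apply: orthonormal_mkbasis => //.
  - by case: f1E => ->; rewrite ?dotpNl ?dotpNr ?opprK.
  - by rewrite dotp_crossp g1 f2f2 gf2 expr0n subr0 mulr1.
  - by case: f1E => ->; rewrite ?dotpNl ?gf2 ?oppr0.
  - by case: f1E => ->; rewrite ?dotpNl !vecE; ring.
  - by rewrite !vecE; ring.
move=> u us_u i.
have [s [t [s0 t0 uE]]] := cone_us u us_u.
have {}uE : u = dotp g u *: g + (s *: v1 + t *: v2) by rewrite -uE addrC subrK.
have en0 : 0 <= (enorm v1)^-1 by rewrite invr_ge0 sqrtr_ge0.
case: (ord3P i) => ->; rewrite col_mkbasis.
- rewrite /f1; case: ifP side => [/allP/(_ u us_u)//|_ /= /allP/(_ u us_u)].
  by rewrite dotpNl oppr_ge0.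
- rewrite uE !dotpDr !dotpZr !dotpZl [dotp v1 g]dotpC p1 !mulr0 add0r.
  by rewrite addr_ge0 ?mulr_ge0 // dotp_ge0.
- have -> : dotp (crossp g (sproj v1)) u = (enorm v1)^-1 * det3 g v1 u.
    by rewrite /det3 /sproj !vecE; ring.
  rewrite mulr_ge0 // uE.
  have -> : det3 g v1 (dotp g u *: g + (s *: v1 + t *: v2)) =
     t * det3 g v1 v2 by rewrite /det3 !vecE; ring.
  by rewrite mulr_ge0.
Qed.

Lemma try_edge_complete us a b : a != 0 -> a \in us ->
  let g := result (unit_normal_ a b) in
  (forall u, u \in us -> 0 <= dotp g u) \/
  (forall u, u \in us -> dotp g u <= 0) ->
  {in us &, forall u v, dotp g u * dotp g v <= dotp u v} ->
  result (try_edge_ us a b) <> None.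
Proof.
move=> a0 aus; have [/sphereP g1 ga _] := result_unit_normal b a0.
cbv zeta; set g := result (unit_normal_ a b) in g1 ga * => side acute.
have projs u v : u \in us -> v \in us -> 0 <= dotp (proj g u) (proj g v).
  by move=> uus vus; rewrite dotp_proj // subr_ge0 acute.
have aE : a = proj g a by rewrite /proj ga scale0r subr0.
rewrite result_try_edge -/g; cbv zeta; have -> : all (fun u => 0 <= dotp g u) us
    || all (fun u => dotp g u <= 0) us.
  by case: side => side; apply/orP; [left|right]; apply/allP.
case E: (result (sweep_ g a a us)) => [[v1 v2]|] // _; move: E.
apply: sweep_complete => [u uus|u uus|u v uus vus]; last exact: projs.
  by rewrite {1}aE projs.
by rewrite {1}aE projs.
Qed.

Lemma result_try_edges_cons us a b es :
  result (try_edges_ us ((a, b) :: es)) =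
  if result (try_edge_ us a b) is Some F then Some F
  else result (try_edges_ us es).
Proof.
transitivity (result (bind (try_edge_ us a b) (fun r =>
  if r is Some F then Ret (Some F) else try_edges_ us es))); first by [].
by rewrite result_bind; case: (result (try_edge_ us a b)).
Qed.

Lemma try_edges_complete us es a b : (a, b) \in es ->
  result (try_edge_ us a b) <> None -> result (try_edges_ us es) <> None.
Proof.
elim: es => // -[a' b'] es IH; rewrite inE result_try_edges_cons.
move=> /predU1P[[-> ->]|ees] eok; first by case: (result (try_edge_ us a' b')) eok.
by case: (result (try_edge_ us a' b')) => //; exact: IH.
Qed.

Lemma try_edges_sound us es F : result (try_edges_ us es) = Some F ->
  exists a b, (a, b) \in es /\ result (try_edge_ us a b) = Some F.
Proof.
elim: es => // -[a b] es IH; rewrite result_try_edges_cons.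
case E: (result (try_edge_ us a b)) => [F'|].
  by case=> <-; exists a, b; rewrite inE eqxx.
by move=> /IH[a' [b' [ees eF]]]; exists a', b'; rewrite inE ees orbT.
Qed.

Lemma cost_halfspace g us : cost (halfspace_ g us) = (8 * size us)%N.
Proof.
by elim: us => // u us IH; rewrite mulnS -IH /= cost_bind /= addn0.
Qed.

Lemma cost_sweep g v1 v2 us : (cost (sweep_ g v1 v2 us) <= 54 * size us)%N.
Proof.
elim: us v1 v2 => // u us IH v1 v2; rewrite mulnS /=.
case: ifP => _ //=; exact: (@leq_add 54 _ 54 _ (leqnn 54) (IH _ _)).
Qed.

Lemma cost_some_orthogonal (x : 'cV[R]_3) : (cost (some_orthogonal_ x) <= 27)%N.
Proof. by rewrite /some_orthogonal_ /=; case: ifP. Qed.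

Lemma cost_unit_normal a b : (cost (unit_normal_ a b) <= 54)%N.
Proof.
rewrite /unit_normal_ 3!cost_bind /=.
have := cost_some_orthogonal a.
by case: ifP => _ /=; lia.
Qed.

Lemma cost_basis_from (s : bool) g v : (cost (basis_from_ s g v) <= 24)%N.
Proof. by rewrite /basis_from_; case: s. Qed.

(** Per vector 8 instructions for the half space test and at most 54 for the sweep;
besides, at most 54 for the normal and 24 for the basis. *)
Lemma cost_try_edge us a b :
  (cost (try_edge_ us a b) <= 78 + 62 * size us)%N.
Proof.
rewrite /try_edge_ 2!cost_bind cost_halfspace.
set g := result (unit_normal_ a b).
have := cost_unit_normal a b; move: (cost _) => c1 h1.
have := cost_sweep g a a us.
case: ifP => _; last by move=> _; rewrite /=; lia.
rewrite cost_bind; move: (cost (sweep_ _ _ _ _)) => c2 h2.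
case: (result (sweep_ _ _ _ _)) => [[v1 v2]|]; last by rewrite /=; lia.
rewrite cost_bind.
have := cost_basis_from (result (halfspace_ g us)).1 g v1.
by move: (cost (basis_from_ _ _ _)) => c3 h3; rewrite /=; lia.
Qed.

Lemma cost_try_edges us es :
  (cost (try_edges_ us es) <= (78 + 62 * size us) * size es)%N.
Proof.
elim: es => [|[a b] es IH]; first by [].
rewrite mulnS; apply: leq_trans (leq_add (cost_try_edge us a b) IH).
have -> : cost (try_edges_ us ((a, b) :: es)) =
  cost (bind (try_edge_ us a b) (fun r =>
    if r is Some F then Ret (Some F) else try_edges_ us es)) by [].
rewrite cost_bind leq_add2l.
by case: (result (try_edge_ us a b)).
Qed.

End Correctness.

(** * The hull-normal algorithm *)

Section Main.
Variables (R : realType) (p : nat) (U : 'M[R]_(3, p)).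
Hypothesis p_gt0 : (0 < p)%N.
Hypothesis U0 : nonzero_cols U.

Let us := [seq col j U | j <- enum 'I_p].

Lemma mem_cols j : col j U \in us.
Proof. by apply: map_f; rewrite mem_enum. Qed.

Lemma colsP u : u \in us -> exists j, u = col j U.
Proof. by case/mapP => j _ ->; exists j. Qed.

Definition hull_edges (ks : seq 'I_p) :=
  let vs := [seq col k U | k <- ks] in zip vs (rot 1 vs).

Lemma hull_edges_map ks :
  hull_edges ks = [seq (col kl.1 U, col kl.2 U) | kl <- zip ks (rot 1 ks)].
Proof.
rewrite /hull_edges -map_rot; elim: ks (rot 1 ks) => [|k ks IH] [|l ls] //=.
by rewrite IH.
Qed.

Lemma hull_edges_sound ks F : result (try_edges_ us (hull_edges ks)) = Some F ->
  nonneg_basis U F.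
Proof.
case/try_edges_sound => a [b [/[!hull_edges_map]/mapP[[k l] _ [-> ->]] eF]].
have [Fo Fnn] := try_edge_sound (U0 k) eF; split=> // i j.
have := Fnn _ (mem_cols j) i; congr (_ <= _).
by rewrite /dotp !mxE; apply: eq_bigr => r _; rewrite !mxE.
Qed.

Lemma nonneg_basis_acute F : nonneg_basis U F ->
  forall k l, 0 <= dotp (col k U) (col l U).
Proof.
move=> [Fo Fnn] k l; have Fo' := mulmx1C Fo.
have -> : dotp (col k U) (col l U) = ((F^T *m U)^T *m (F^T *m U)) k l.
  rewrite trmx_mul trmxK mulmxA -[U^T *m F *m F^T]mulmxA Fo' mulmx1.
  by rewrite /dotp !mxE; apply: eq_bigr => r _; rewrite !mxE.
by rewrite mxE sumr_ge0 // => r _; rewrite mxE mulr_ge0.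
Qed.

(** If all vectors are parallel, any edge will do, and there is one since the hull
has a vertex. Otherwise the edge is the one on the facet of
nonneg_basis_acute_facet. *)
Lemma hull_edges_complete ks F : boundary_traversal U ks -> nonneg_basis U F ->
  result (try_edges_ us (hull_edges ks)) <> None.
Proof.
move=> trav FU; have uu := nonneg_basis_acute FU.
pose normal k l := result (unit_normal_ (col k U) (col l U)).
suff [k [l [kl side acute]]] : exists k l, [/\ (k, l) \in zip ks (rot 1 ks),
    (forall u, u \in us -> 0 <= dotp (normal k l) u) \/
    (forall u, u \in us -> dotp (normal k l) u <= 0) &
    {in us &, forall u v,
      dotp (normal k l) u * dotp (normal k l) v <= dotp u v}].
  apply: (@try_edges_complete _ _ _ (col k U) (col l U)).
    by rewrite hull_edges_map; apply/mapP; exists (k, l).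
  by apply: try_edge_complete; rewrite ?U0 ?mem_cols.
have [par|[n [n0 nu [i [j [ij ni nj]]] good]]] := nonneg_basis_acute_facet U0 FU.
  (* All vectors are orthogonal to any n orthogonal to one of them, so each of them
  gives a vertex. *)
  pose k0 : 'I_p := Ordinal p_gt0.
  have [n0 nk0] := result_some_orthogonal (U0 k0).
  set n := result _ in n0 nk0.
  have V0 : hull_vertices U (sproj (col k0 U)).
    apply: (supported_vertex U0 (sum_cols_gt0 U0 uu) n0 (oner_neq0 _)) => // k.
      have /crossp_eq0_parallel e := par k k0.
      have k00 : 0 < dotp (col k0 U) (col k0 U) by rewrite dotp_gt0.
      rewrite -(pmulr_rge0 _ k00).
      by rewrite -dotpZr e dotpZr nk0 mulr0.
    by rewrite /det3 par dotp0r mulr0.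
  have [k kks _] := (traversal_vertexP trav _).1 V0.
  have [l kl] : exists l, (k, l) \in zip ks (rot 1 ks).
    case: (rot_to kks) => r ks' eks.
    exists (head k ks'); rewrite -(mem_rot r) -zip_rot ?size_rot // rot_rot.
    by rewrite eks rot1_cons; case: ks' {eks} => [|l ks'] /=; rewrite inE eqxx.
  exists k, l; have [_ ga _] := result_unit_normal (col l U) (U0 k).
  rewrite -/(normal k l) in ga; set g := normal k l in ga *.
  have gu u : u \in us -> dotp g u = 0.
    case/colsP => m ->; have /crossp_eq0_parallel/(congr1 (dotp g)) := par m k.
    rewrite !dotpZr ga mulr0 => /eqP; rewrite mulf_eq0 dotp_eq0.
    by rewrite (negbTE (U0 k)) => /eqP.
  split=> //; first by left=> u /gu->.
  by move=> u v uus vus; rewrite !gu // mul0r; have [m ->] := colsP uus;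
    have [m' ->] := colsP vus.
have [k [l [kl klx nk nl]]] := facet_edge_traversed U0 uu trav nu ij ni nj n0.
exists k, l; have [/sphereP g1 _ gE] := result_unit_normal (col l U) (U0 k).
rewrite -/(normal k l) in g1 gE; set g := normal k l in g1 gE *.
have {}gE := gE klx.
have nn : 0 < dotp n n by rewrite dotp_gt0.
have [mu gmu] : exists mu, g = mu *: n.
  exists ((enorm (crossp (col k U) (col l U)))^-1 *
    (det3 n (col k U) (col l U) / dotp n n)).
  rewrite gE /sproj -scalerA; congr (_ *: _).
  apply: (scalerI (lt0r_neq0 nn)); rewrite scalerA mulrCA mulfV ?gt_eqF // mulr1.
  exact: plane_crossp.
have mun : mu ^+ 2 * dotp n n = 1 by rewrite -g1 gmu dotpZl dotpZr mulrA.
have gu u : dotp g u = mu * dotp n u by rewrite gmu dotpZl.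
split=> //.
  have [mu0|mu0] := leP 0 mu; [left|right] => u /colsP[m ->]; rewrite gu.
    by rewrite mulr_ge0.
  by rewrite mulr_le0_ge0 // ltW.
move=> u v /colsP[m ->] /colsP[m' ->]; rewrite !gu mulrACA -expr2.
rewrite -[leRHS]mul1r -mun -mulrA; apply: ler_wpM2l; [exact: sqr_ge0|exact: good].
Qed.

End Main.

Theorem theorem3p9 (R : realType) (hull : hull_routine)
    (hull_ok : hull_routine_correct R hull)
    (hull_fast : hull_routine_cost R hull) :
  (exists C : R, forall (p m : nat) (U : 'M[R]_(3, p)),
     (0 < p)%N -> nonzero_cols U -> (hull_vertices U #= `I_m)%card ->
     (exists F : 'M[R]_3, nonneg_basis U F) ->
     (exists2 F : 'M[R]_3,
        result (hull_normal hull U) = Some F & nonneg_basis U F) /\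
     (cost (hull_normal hull U))%:R <= C * (p%:R ^+ 2 * logm R m)) /\
  (forall (p : nat) (U : 'M[R]_(3, p)),
     (0 < p)%N -> nonzero_cols U ->
     ~ (exists F : 'M[R]_3, nonneg_basis U F) ->
     result (hull_normal hull U) = None).
Proof.
have resE p (U : 'M[R]_(3, p)) : result (hull_normal hull U) =
    result (try_edges_ [seq col j U | j <- enum 'I_p]
      (hull_edges U (result (hull R p U)))).
  by rewrite /hull_normal result_bind.
split; last first.
  move=> p U p0 U0 noF; case E: (result _) => [F|//]; case: noF; exists F.
  by rewrite resE in E; exact: hull_edges_sound E.
have [C0 C0P] := hull_fast.
(* Trying one edge costs at most 78 + 62 p <= 140 p, and logm is at least ln 2. *)
exists (`|C0| + 140 / ln 2) => p m U p0 U0 mcard [F FU].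
have trav := hull_ok p U p0 U0.
split.
  case E: (result _) => [F'|]; rewrite resE in E.
    by exists F'; last exact: hull_edges_sound E.
  by case: (hull_edges_complete p0 U0 trav FU E).
have size_ks : (size (result (hull R p U)) <= p)%N.
  have [uv _ _] := trav.
  have := uniq_leq_size (map_uniq uv) (fun k _ => mem_enum 'I_p k : k \in enum 'I_p).
  by rewrite size_enum_ord.
have cost_le : (cost (hull_normal hull U) <=
    cost (hull R p U) + 140 * p ^ 2)%N.
  rewrite /hull_normal cost_bind leq_add2l.
  apply: leq_trans (cost_try_edges _ _) _.
  rewrite size_zip size_rot !size_map -enumT size_enum_ord minnn.
  by nia.
have ln2 : 0 < ln 2 :> R by rewrite ln_gt0 // ltr1n.
have lm : ln 2 <= logm R m.
  by rewrite /logm ler_ln ?posrE ?ltr0n ?ler_nat ?leq_maxr // leq_max orbT.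
have lm0 : 0 < logm R m := lt_le_trans ln2 lm.
have p1 : 1 <= p%:R :> R by rewrite ler1n.
apply: le_trans (_ : (cost (hull R p U) + 140 * p ^ 2)%:R <= _).
  by rewrite ler_nat.
rewrite natrD natrM natrX [leRHS]mulrDl; apply: lerD.
  apply: le_trans (C0P p m U p0 U0 mcard) _.
  apply: le_trans (_ : `|C0| * (p%:R * logm R m) <= _).
    by rewrite ler_wpM2r ?ler_norm // mulr_ge0 // ltW.
  rewrite ler_wpM2l // ler_wpM2r ?(ltW lm0) // expr2 ler_peMl //.
rewrite -mulrA ler_wpM2l //.
rewrite mulrCA ler_peMr ?sqr_ge0 //.
by rewrite mulrC ler_pdivlMr // mul1r.
Qed.
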